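(* Let $A$ and $B$ be TDLC groups which are compactly generated relative to finite collections of open subgroups $\mathcal H_A$ and $\mathcal H_B$, respectively. Let $G=A\ast_C B$ be a (non-trivial) amalgamated free product of topological groups such that $A$ is hyperbolic relative to $\mathcal H_A$, $B$ is hyperbolic relative to $\mathcal H_B$, and $C$ is compact. Then $G$ is hyperbolic relative to $\mathcal H_A\cup\mathcal H_B$.
   Context: All topological groups are Hausdorff. A TDLC group is a totally disconnected locally compact group. All graphs are connected and edges have length one. Amalgamated free product: $C$ is a topological group with topological isomorphisms $i_A:C\to A$, $i_B:C\to B$ onto open subgroups of $A$ and $B$, and $G=A\ast_C B$ is the amalgam identifying $i_A(c)$ with $i_B(c)$ for all $c\in C$. $G$ carries the unique group topology for which the inclusions $A\to G$ and $B\to G$ are open topological embeddings. The amalgam is non-trivial: $i_A(C)\neq A$ and $i_B(C)\neq B$. Let $G$ be a TDLC group and $\mathcal H$ a finite collection of open subgroups. $G$ is compactly generated relative to $\mathcal H$ if there is a compact $K\subset G$ such that $K\cup\bigcup_{H\in\mathcal H}H$ algebraically generates $G$. $(G,\mathcal H)$ is a proper pair if no two distinct non-compact subgroups in $\mathcal H$ are conjugate in $G$. A Cayley-Abels graph of $G$ with respect to $\mathcal H$ (for a proper pair $(G,\mathcal H)$) is a connected simplicial graph $X$ on which $G$ acts cocompactly and discretely (pointwise stabilizers of cells are open subgroups) such that: (1) edge $G$-stabilizers are compact; (2) vertex $G$-stabilizers are either compact or conjugates of subgroups in $\mathcal H$; (3) every $H\in\mathcal H$ is the $G$-stabilizer of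 a vertex of $X$; (4) any two vertices of $X$ with the same $G$-stabilizer $H\in\mathcal H$ are in the same $G$-orbit if $H$ is non-compact. A simplicial graph is fine if for any vertices $u,v$ and any $n\in\mathbb N$ there are only finitely many embedded paths of length $n$ from $u$ to $v$. $G$ is hyperbolic relative to $\mathcal H$ if $(G,\mathcal H)$ is a proper pair and there exists a Cayley-Abels graph of $G$ with respect to $\mathcal H$ that is fine and Gromov hyperbolic. *)

(* Defs.v *)
From HB Require Import structures.
From mathcomp Require Import all_boot all_order all_algebra.
From mathcomp Require Import all_classical all_reals all_analysis.

Set Implicit Arguments.
Unset Strict Implicit.
Unset Printing Implicit Defensive.

Import Order.TTheory GRing.Theory Num.Theory.

Local Open Scope classical_set_scope.

(* Multiplicative, possibly infinite, topological groups.  The Hausdorff axiom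
   is not bundled here: it is part of [tdlc]. *)
HB.mixin Record Group_isTopologicalGroup G of Group G & Topological G := {
  mulg_continuous : continuous (fun x : G * G => (x.1 * x.2)%g) ;
  invg_continuous : continuous (fun x : G => (x^-1)%g)
}.

#[short(type="topologicalGroupType")]
HB.structure Definition TopologicalGroup :=
  {G of Group G & Topological G & Group_isTopologicalGroup G}.

Definition tdlc (G : topologicalGroupType) : Prop :=
  [/\ hausdorff_space G, totally_disconnected [set: G]
    & locally_compact [set: G]].

Definition subgroup (G : groupType) (H : set G) : Prop :=
  H 1%g /\ forall x y, H x -> H y -> H (x / y)%g.

Definition conjugate (G : groupType) (H K : set G) : Prop :=
  exists g : G, K = [set (x ^ g)%g | x in H].

Definition open_subgroup (G : topologicalGroupType) (H : set G) : Prop :=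
  subgroup H /\ open H.

Definition finite_open_collection (G : topologicalGroupType)
    (HH : set (set G)) : Prop :=
  finite_set HH /\ forall H, HH H -> open_subgroup H.

Definition compactly_generated_rel (G : topologicalGroupType)
    (HH : set (set G)) : Prop :=
  exists2 K : set G, compact K &
    smallest (@subgroup G) (K `|` \bigcup_(H in HH) H) = [set: G].

Definition proper_pair (G : topologicalGroupType) (HH : set (set G)) : Prop :=
  [/\ tdlc G, finite_open_collection HH &
      forall H K, HH H -> HH K -> ~ compact H -> ~ compact K ->
        conjugate H K -> H = K].

Definition open_embedding (S T : topologicalType) (f : S -> T) : Prop :=
  [/\ injective f, continuous f & forall U, open U -> open (f @` U)].

(* [jA], [jB] exhibit [G] as the pushout of [iA] and [iB] in groups, i.e. as
   the amalgam of [A] and [B] along the identifications iA c = iB c. *)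
Definition is_amalgam (A B C G : groupType)
    (iA : {multiplicative C -> A}) (iB : {multiplicative C -> B})
    (jA : {multiplicative A -> G}) (jB : {multiplicative B -> G}) : Prop :=
  jA \o iA =1 jB \o iB /\
  forall (T : groupType)
    (f : {multiplicative A -> T}) (g : {multiplicative B -> T}),
    f \o iA =1 g \o iB ->
    exists h : {multiplicative G -> T},
      [/\ h \o jA =1 f, h \o jB =1 g &
          forall h' : {multiplicative G -> T},
            h' \o jA =1 f -> h' \o jB =1 g -> h' =1 h].

Definition topological_amalgam (A B C G : topologicalGroupType)
    (iA : {multiplicative C -> A}) (iB : {multiplicative C -> B})
    (jA : {multiplicative A -> G}) (jB : {multiplicative B -> G}) : Prop :=
  [/\ open_embedding iA, open_embedding iB, is_amalgam iA iB jA jB,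
      open_embedding jA & open_embedding jB].

(* A simplicial graph is a symmetric irreflexive adjacency relation [e]; edge
   paths are those of the library: [path e u p], ending at [last u p]. *)

Definition connected_simplicial_graph (V : choiceType) (e : rel V) : Prop :=
  [/\ symmetric e, irreflexive e, inhabited V &
      forall u v, exists2 p, path e u p & last u p = v].

Definition fine_graph (V : choiceType) (e : rel V) : Prop :=
  forall (u v : V) (n : nat),
    finite_set [set p | [/\ path e u p, last u p = v, uniq (u :: p)
                          & size p = n]].

Definition graph_action (G : groupType) (V : choiceType) (e : rel V)
    (act : G -> V -> V) : Prop :=
  [/\ forall v, act 1%g v = v,
      forall g h v, act (g * h)%g v = act g (act h v)
    & forall g u v, e (act g u) (act g v) = e u v].

Definition vertex_stab (G : groupType) (V : choiceType) (act : G -> V -> V)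
  (v : V) : set G := [set g | act g v = v].

Definition edge_pstab (G : groupType) (V : choiceType) (act : G -> V -> V)
  (u v : V) : set G := vertex_stab act u `&` vertex_stab act v.

(* Setwise stabilizer of the edge {u, v}: inversions are allowed. *)
Definition edge_stab (G : groupType) (V : choiceType) (act : G -> V -> V)
  (u v : V) : set G := [set g | act g @` [set u; v] = [set u; v]].

Definition discrete_action (G : topologicalGroupType) (V : choiceType)
    (e : rel V) (act : G -> V -> V) : Prop :=
  (forall v, open (vertex_stab act v)) /\
  (forall u v, e u v -> open (edge_pstab act u v)).

(* The translates of a finite subgraph, the one induced on [F], cover. *)
Definition cocompact_action (G : groupType) (V : choiceType)
    (e : rel V) (act : G -> V -> V) : Prop :=
  exists F : set V,
    [/\ finite_set F,
        forall v, exists g, exists2 x, F x & v = act g x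
      & forall u v, e u v -> exists g x y,
          [/\ F x, F y, u = act g x & v = act g y]].

Definition cayley_abels (G : topologicalGroupType) (HH : set (set G))
    (V : choiceType) (e : rel V) (act : G -> V -> V) : Prop :=
  [/\ connected_simplicial_graph e,
      graph_action e act,
      cocompact_action e act &
      discrete_action e act] /\
  [/\ forall u v, e u v -> compact (edge_stab act u v),
      forall v, compact (vertex_stab act v) \/
        (exists2 H, HH H & conjugate H (vertex_stab act v)),
      forall H, HH H -> exists v, vertex_stab act v = H
    & forall H u v, HH H -> ~ compact H ->
        vertex_stab act u = H -> vertex_stab act v = H ->
        exists g, v = act g u].

Local Open Scope ring_scope.

Definition gromov_product (R : realType) (X : Type) (d : X -> X -> R)
  (w x y : X) : R := (d x w + d y w - d x y) / 2.

Definition gromov_hyperbolic (R : realType) (X : Type) (D : set X)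
    (d : X -> X -> R) : Prop :=
  exists delta : R, forall w x y z, D w -> D x -> D y -> D z ->
    Num.min (gromov_product d w x y) (gromov_product d w y z) - delta
      <= gromov_product d w x z.

Definition vdist (R : realType) (V : choiceType) (e : rel V) (u v : V) : R :=
  inf [set (size p)%:R | p in [set p | path e u p /\ last u p = v]].

(* The graph as a metric space, with edges of length one: (u, v, t) is the
   point of the edge {u, v} at distance t from u.  Thus (u, v, t) and
   (v, u, 1 - t) name the same point (they are at distance 0), and (u, u, 0)
   names the vertex u. *)
Definition gpoint (R : realType) (V : choiceType) (e : rel V) :
    set (V * V * R) :=
  [set p | (e p.1.1 p.1.2 /\ 0 <= p.2 <= 1) \/ (p.1.1 = p.1.2 /\ p.2 = 0)].

(* A shortest path either leaves the edge of the first point by one of its two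
   ends and enters that of the second point by one of its two ends, or stays in
   a common edge. *)
Definition gdist (R : realType) (V : choiceType) (e : rel V)
    (p q : V * V * R) : R :=
  let: (u, v, s) := p in
  let: (u', v', t) := q in
  let d := vdist R e in
  let through :=
    Num.min (Num.min (s + d u u' + t) (s + d u v' + (1 - t)))
            (Num.min (1 - s + d v u' + t) (1 - s + d v v' + (1 - t))) in
  if (u == u') && (v == v') then Num.min `|s - t| through
  else if (u == v') && (v == u') then Num.min `|s - (1 - t)| through
  else through.

Definition hyperbolic_graph (R : realType) (V : choiceType) (e : rel V) :
    Prop := gromov_hyperbolic (@gpoint R V e) (gdist e).

Definition hyperbolic_rel (R : realType) (G : topologicalGroupType)
    (HH : set (set G)) : Prop :=
  proper_pair HH /\
  exists (V : choiceType) (e : rel V) (act : G -> V -> V),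
    [/\ cayley_abels HH e act, fine_graph e & hyperbolic_graph R e].

(* Main.v *)
From HB Require Import structures.
Require Import Defs.
From mathcomp Require Import all_boot all_order all_algebra.
From mathcomp Require Import all_classical all_reals all_analysis.
From mathcomp Require Import zify lra.

(* Let X_A and X_B be fine hyperbolic Cayley-Abels graphs of A and B.  First
   make C the stabilizer of a vertex of each: fix a finite connected
   C-invariant set F of vertices of X_A and attach to every translate aF, for
   a C in A/C, a cone whose legs are longer than the diameter of F.  Then X_A
   sits isometrically and coboundedly in the new graph, which is therefore
   hyperbolic; it is fine because an edge of X_A lies in finitely many
   translates of F.  Let P_A and P_B be the graphs obtained, with vertices
   *_A and *_B of stabilizer C.

   The graph for G is the disjoint union of the translates g P_A (g in G/A) and
   g P_B (g in G/B) together with a bridge from g *_A to g *_B for every g C.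
   Each bridge separates it.  Instead of normal forms, this uses the universal
   property: the homomorphisms a |-> (0, a) and b |-> (m - b m, b) from A and B
   into the semidirect product of the Z/2-valued functions on G by G, where m is
   the indicator of C, agree on C, and the cocycle of the induced homomorphism
   tells on which side of a bridge a vertex lies.  Hence every copy of P_A or
   P_B is a retract of the whole graph, and an edge that moves under the
   retraction lies in that copy.  Fineness and hyperbolicity pass from the
   pieces to the whole, and a subgroup fixing points in two different pieces
   fixes a bridge, so it is compact if it is open. *)

Set Implicit Arguments.
Unset Strict Implicit.
Unset Printing Implicit Defensive.

Import Order.TTheory GRing.Theory Num.Theory.

Local Open Scope classical_set_scope.

(** * Walks and fine graphs *)

Section Walks.
Variables (V : choiceType) (e : rel V).
Implicit Types (D : set V) (u v w : V) (m n : nat).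

(** A walk may stop at any step, so [n] only bounds its length. This makes walks monotone in [n] and
    lets maps that collapse edges preserve the bound. *)
Fixpoint walk D n u v : Prop :=
  if n is n'.+1 then D u /\ (u = v \/ exists2 w, e u w & walk D n' w v)
  else D u /\ u = v.

Lemma walk_src D n u v : walk D n u v -> D u.
Proof. by case: n => [|n] []. Qed.

Lemma walk_refl D n u : D u -> walk D n u u.
Proof. by case: n => [|n] Du; split=> //; left. Qed.

Lemma walk_step D n u w v : D u -> e u w -> walk D n w v -> walk D n.+1 u v.
Proof. by move=> Du uw wv; split=> //; right; exists w. Qed.

Lemma walk_mono D D' m n u v :
  D `<=` D' -> (m <= n)%N -> walk D m u v -> walk D' n u v.
Proof.
move=> DD; elim: m n u => [|m IH] [|n] u //=.
- by move=> _ [/DD Du <-].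
- by move=> _ [/DD Du <-]; split=> //; left.
- rewrite ltnS => mn [/DD Du [<-|[w uw wv]]]; split=> //; first by left.
  by right; exists w => //; exact: IH.
Qed.

Lemma walk_dst D n u v : walk D n u v -> D v.
Proof.
by elim: n u => [|n IH] u /= [Du]; [move=> <-|case=> [<- //|[w _ /IH]]].
Qed.

Lemma walk_cat D m n u w v :
  walk D m u w -> walk D n w v -> walk D (m + n) u v.
Proof.
elim: m u => [|m IH] u /=; first by case=> _ ->.
case=> Du [->|[x ux xw]] wv.
  by apply: (@walk_mono D D n (m.+1 + n)) => //; lia.
by split=> //; right; exists x => //; exact: IH.
Qed.

Lemma walk1 D u v : D u -> D v -> e u v -> walk D 1 u v.
Proof. by move=> Du Dv uv; apply: (walk_step Du uv). Qed.

Lemma walk_sym D n u v : symmetric e -> walk D n u v -> walk D n v u.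
Proof.
move=> es; elim: n u => [|n IH] u /=; first by case=> Du <-.
case=> Du [<-|[w uw wv]]; first by split=> //; left.
rewrite -[_ /\ _]/(walk D n.+1 v u) -addn1; apply: (walk_cat (IH _ wv));
  apply: walk1 => //.
  exact: walk_src wv.
by rewrite es.
Qed.

Lemma walkP D n u v : walk D n u v <->
  exists p, [/\ path e u p, last u p = v, (size p <= n)%N
              & forall x, x \in u :: p -> D x].
Proof.
elim: n u => [|n IH] u; split=> /=.
- by case=> Du <-; exists [::]; split=> // x; rewrite inE => /eqP ->.
- by case=> -[|x p] [] //= _ <- _ Du; split=> //; apply: Du; rewrite inE.
- case=> Du [<-|[w uw /IH [p [pp lp sp Dp]]]].
    by exists [::]; split=> // x; rewrite inE => /eqP ->.
  exists (w :: p); split=> //=; first by rewrite uw.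
  by move=> x; rewrite inE => /orP [/eqP -> //|]; exact: Dp.
- case=> -[|w p] [] /=.
    by move=> _ -> _ Du; split; [apply: Du; rewrite inE|left].
  move=> /andP [uw pp] lp sp Du; split; first by apply: Du; rewrite inE eqxx.
  right; exists w => //; apply/IH; exists p; split=> //.
  by move=> x xp; apply: Du; rewrite inE xp orbT.
Qed.

(** The walk is cut just before its first visit to [c], if there is one. *)
Lemma walk_hit D n u v c : u <> c -> walk D n u v ->
  walk (D `&` [set~ c]) n u v \/
  exists y, [/\ e y c, D c & walk (D `&` [set~ c]) n u y].
Proof.
elim: n u => [|n IH] u uc /=; first by case=> Du <-; left; split.
case=> Du [<-|[w uw wv]]; first by left; split=> //; left.
have [wc|wc] := pselect (w = c).
  right; exists u; rewrite -wc; split=> //; first exact: walk_src wv.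
  by split; [split=> //; rewrite wc|left].
case: (IH w wc wv) => [wv'|[y [yc Dc wy]]].
  by left; split=> //; right; exists w.
by right; exists y; split=> //; split=> //; right; exists w.
Qed.

Lemma walk_lipschitz (phi : V -> nat) D n u v :
  (forall x y, e x y -> (phi y <= phi x + 1)%N) ->
  walk D n u v -> (phi v <= phi u + n)%N.
Proof.
move=> lip; elim: n u => [|n IH] u /=; first by case=> _ ->; lia.
by case=> _ [->|[w /lip uw /IH]]; lia.
Qed.

(** The value 0 for vertices not joined by a walk is a dummy; the distance is evaluated in connected
    graphs. *)
Definition dist u v : nat :=
  if pselect (exists n, `[< walk setT n u v >]) is left h then ex_minn h else
    0%N.

Lemma dist_le n u v : walk setT n u v -> (dist u v <= n)%N.
Proof.
move=> uv; rewrite /dist; case: pselect => // h.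
by case: ex_minnP => m _; apply; exact/asboolP.
Qed.

Lemma dist_refl u : dist u u = 0%N.
Proof. by apply/eqP; rewrite -leqn0; apply: dist_le. Qed.

Section Connected.
Hypothesis econn : forall u v, exists2 p, path e u p & last u p = v.

Lemma dist_walk u v : walk setT (dist u v) u v.
Proof.
rewrite /dist; case: pselect => [h|[]]; first by case: ex_minnP => m /asboolP.
have [p pp lp] := econn u v; exists (size p); apply/asboolP/walkP.
by exists p.
Qed.

Lemma dist_triangle w u v : (dist u v <= dist u w + dist w v)%N.
Proof. by apply: dist_le; apply: walk_cat; exact: dist_walk. Qed.

Lemma dist_sym u v : symmetric e -> dist u v = dist v u.
Proof.
move=> es; apply/eqP; rewrite eqn_leq.
by apply/andP; split; apply: dist_le; apply: walk_sym => //; exact: dist_walk.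
Qed.

Lemma vdistE (R : realType) u v : vdist R e u v = ((dist u v)%:R)%R.
Proof.
rewrite /vdist; set S := [set _ | _ in _].
have /walkP [p [pp lp sp _]] := dist_walk u v.
have lbS : lbound S ((dist u v)%:R)%R.
  move=> _ [q [qq lq] <-]; rewrite ler_nat; apply: dist_le.
  by apply/walkP; exists q.
have Sd : S ((dist u v)%:R)%R.
  exists p => //; congr (_%:R)%R; apply/eqP; rewrite eqn_leq sp /=.
  by apply: dist_le; apply/walkP; exists p.
apply/eqP; rewrite eq_le; apply/andP; split.
  by apply: ge_inf => //; exists ((dist u v)%:R)%R.
by apply: lb_le_inf => //; exists ((dist u v)%:R)%R.
Qed.

End Connected.

Definition detour u v n : set V := [set y | e u y /\ walk [set~ u] n y v].

(* An embedded path from u is an edge (u, y) followed by an embedded path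
   avoiding u, and walks avoiding u can be shortened to embedded paths. *)
Lemma fine_graphP :
  fine_graph e <-> forall u v n, finite_set (detour u v n).
Proof.
split=> fe u v n.
  (* An embedded path from [y] with at most [n] edges, preceded by the edge from [u], has length at
     most n + 1, and [head] recovers [y] from it. *)
  apply: (@sub_finite_set _ _ (\bigcup_(k in `I_n.+2) ((fun p => head u p) @`
     [set p | [/\ path e u p, last u p = v, uniq (u :: p) & size p = k]]))).
    move=> y [uy /walkP [p [pp lp sp Dp]]].
    case/shortenP: pp lp Dp => p' pp' up' sub lp Dp.
    exists (size p').+1 => /=.
      have /= le : (size (y :: p') <= size (y :: p))%N.
        apply: uniq_leq_size => // x.
        by rewrite !inE => /orP [->//|/sub ->]; rewrite orbT.
      by rewrite ltnS; apply: leq_trans le _.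
    exists (y :: p') => //; split=> //=; first by rewrite uy.
    rewrite -/(uniq (y :: p')) up' andbT; apply/negP => uy'.
    have /Dp : u \in y :: p.
      by move: uy'; rewrite !inE => /orP [->//|/sub ->]; rewrite orbT.
    exact.
  by apply: bigcup_finite => // k _; apply: finite_image; exact: fe.
elim: n u => [|n IH] u.
  apply: (sub_finite_set _ (finite_set1 [::])) => p [_ _ _].
  by move/size0nil.
apply: (@sub_finite_set _ _ (\bigcup_(y in detour u v n) (cons y @`
  [set p | [/\ path e y p, last y p = v, uniq (y :: p) & size p = n]]))).
  move=> [|y p] [] //= /andP [uy pp] lp /andP [up upp] [sp].
  exists y; last by exists p.
  split=> //; apply/walkP; exists p; split=> //; first by rewrite sp.
  by move=> x xp xu; rewrite -xu xp in up.
by apply: bigcup_finite => // y _; apply: finite_image; exact: IH.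
Qed.

End Walks.

(** * Hyperbolicity *)

Section Hyperbolicity.
Local Open Scope ring_scope.
Variable R : realType.

(** Each Gromov product changes by at most 3k/2 under [f], and the inequality compares two of them,
    whence the constant 3k. *)
Lemma gromov_hyperbolic_transfer (X X' : Type) (D : set X) (D' : set X')
    (d : X -> X -> R) (d' : X' -> X' -> R) (f : X' -> X) (k : R) :
  (forall x, D' x -> D (f x)) ->
  (forall x y, D' x -> D' y -> `|d' x y - d (f x) (f y)| <= k) ->
  gromov_hyperbolic D d -> gromov_hyperbolic D' d'.
Proof.
move=> Df close [delta hyp]; exists (delta + 3 * k) => w x y z Dw Dx Dy Dz.
have := hyp _ _ _ _ (Df _ Dw) (Df _ Dx) (Df _ Dy) (Df _ Dz).
have := close _ _ Dx Dw; have := close _ _ Dy Dw; have := close _ _ Dz Dw.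
have := close _ _ Dx Dy; have := close _ _ Dy Dz; have := close _ _ Dx Dz.
rewrite /gromov_product !ler_norml => /andP [? ?] /andP [? ?] /andP [? ?].
move=> /andP [? ?] /andP [? ?] /andP [? ?].
by rewrite !minEle; case: ifPn; case: ifPn; lra.
Qed.

Lemma minB_le (a b c delta : R) : Num.min a b - delta <= c <->
  (a - delta <= c \/ b - delta <= c).
Proof.
by rewrite minEle; case: ifPn => ?; split; first [by left; lra|by right;
  lra|lra].
Qed.

(* With (x|y) based at o, xy + zw >= min (xz + yw, xw + yz) - 2 delta, which is
   the inequality based at w since the terms in d o cancel. *)
Lemma gromov_hyperbolic_basepoint (X : Type) (d : X -> X -> R) (o : X)
    (delta : R) :
  (forall x y, d x y = d y x) ->
  (forall x y z, Num.min (gromov_product d o x y) (gromov_product d o y z)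
     - delta <= gromov_product d o x z) ->
  gromov_hyperbolic setT d.
Proof.
move=> ds hyp; exists (2 * delta) => w x y z _ _ _ _.
have := hyp x y z; have := hyp x w z; have := hyp y x w; have := hyp y z w.
rewrite /gromov_product (ds y x) (ds w z).
move=> /minB_le h1 /minB_le h2 /minB_le h3 /minB_le h4.
by rewrite !minEle; case: ifPn => ?; move: h1 h2 h3 h4; lra.
Qed.

Section Graph.
Variables (V : choiceType) (e : rel V).
Hypotheses (es : symmetric e)
  (econn : forall u v, exists2 p, path e u p & last u p = v).

Definition rdist (u v : V) : R := (dist e u v)%:R.

Lemma rdist_sym u v : rdist u v = rdist v u.
Proof. by rewrite /rdist dist_sym. Qed.

Lemma rdist_ge0 u v : 0 <= rdist u v.
Proof. exact: ler0n. Qed.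

Lemma rdistxx u : rdist u u = 0.
Proof. by rewrite /rdist dist_refl. Qed.

Lemma rdist_triangle w u v : rdist u v <= rdist u w + rdist w v.
Proof. by rewrite /rdist -natrD ler_nat; exact: dist_triangle. Qed.

Lemma gdist_vertex (u v : V) : gdist e (u, u, 0) (v, v, 0) = rdist u v.
Proof.
have d0 := rdist_ge0 u v.
rewrite /gdist !vdistE // -/(rdist u v) subrr normr0.
have [->|_] := eqVneq u v; rewrite /= ?rdistxx !minEle; repeat case: ifPn; lra.
Qed.

(** Each point is within distance one of the first end of its edge. *)
Lemma gdist_close (u v u' v' : V) (s t : R) :
  gpoint e (u, v, s) -> gpoint e (u', v', t) ->
  `|gdist e (u, v, s) (u', v', t) - rdist u u'| <= 2.
Proof.
have bnd (x y : V) (r : R) : gpoint e (x, y, r) ->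
    0 <= r <= 1 /\ rdist x y <= 1.
  case=> -[/= exy r01].
    by split=> //; rewrite /rdist -[leRHS]/(1%:R) ler_nat; apply: dist_le;
      exact: walk1.
  by rewrite exy r01 rdistxx lexx ler01.
move=> /bnd [/andP [s0 s1] uv] /bnd [/andP [t0 t1] u'v'].
have d0 := rdist_ge0 u u'.
have d1 := rdist_triangle v' u u'; have d2 := rdist_triangle v u u'.
have d3 := rdist_triangle v' v u'; rewrite (rdist_sym v' u') in d1 d3.
rewrite /gdist !vdistE // -!/(rdist _ _).
set th := Num.min (Num.min _ _) _.
have thb : rdist u u' - 2 <= th <= rdist u u' + 2.
  apply/andP; split.
    by rewrite /th !le_min; apply/andP; split; apply/andP; split; lra.
  by rewrite /th !ge_min; apply/orP; left; apply/orP; left; lra.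
move: th thb => th thb.
(* On a common edge the direct route competes with [through], but there the first ends are at
   distance at most one, so the second alternative is impossible. *)
have absle (x : R) : 0 <= x -> `|Num.min x th - rdist u u'| <= 2 \/ rdist u u'
  > 1.
  have [?|?] := ltP 1 (rdist u u'); first by right.
  by left; rewrite ler_norml minEle; case: ifPn => ?; lra.
case: ifPn => [/andP [/eqP eu /eqP ev]|_].
  case: (absle `|s - t|) => //.
  by rewrite -eu rdistxx; lra.
case: ifPn => [/andP [/eqP eu /eqP ev]|_].
  case: (absle `|s - (1 - t)|) => //.
  by rewrite -ev; lra.
by rewrite ler_norml; lra.
Qed.

(** Vertices embed isometrically as the points [(u, u, 0)]; conversely, sending a point to the first
    end of its edge changes distances by at most 2. *)
Lemma hyperbolic_graphP :
  hyperbolic_graph R e <-> gromov_hyperbolic [set: V] rdist.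
Proof.
split; rewrite /hyperbolic_graph.
  apply: (@gromov_hyperbolic_transfer _ _ _ _ _ _ (fun u => (u, u, 0)) 0).
    by move=> u _; right.
  by move=> u v _ _; rewrite gdist_vertex subrr normr0.
apply: (@gromov_hyperbolic_transfer _ _ _ _ _ _ (fun p => p.1.1) 2) => //.
by move=> [[u v] s] [[u' v'] t]; exact: gdist_close.
Qed.

End Graph.

End Hyperbolicity.

(** * Attaching finite pieces to a fine graph *)

Section AttachFine.
Variables (V W : choiceType) (I : Type) (e : rel V) (e' : rel (V + W)%type).
Variables (kappa : W -> I) (fill : I -> set V) (L : nat).
Hypotheses (es : symmetric e) (es' : symmetric e')
  (eVV : forall u v, e' (inl u) (inl v) = e u v)
  (eVW : forall u w, e' (inl u) (inr w) -> fill (kappa w) u)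
  (eWW : forall w w', e' (inr w) (inr w') -> kappa w = kappa w')
  (kappa_fin : forall i, finite_set [set w | kappa w = i])
  (fill_fin : forall i, finite_set (fill i))
  (fill_conn : forall i u v, fill i u -> fill i v -> walk e (fill i) L u v)
  (fill_edge : forall u v, e u v -> finite_set [set i | fill i u /\ fill i v])
  (efine : fine_graph e).

(** The old vertices that may stand for [z] when a walk in the large graph is imitated in the old
    one: crossing a piece is replaced by a walk inside its [fill]. *)
Let shadow (z : V + W) : set V :=
  match z with inl x => [set x] | inr w => fill (kappa w) end.

(* When a walk crosses a piece containing u, consider the last neighbour of u
   before and the first one after u on a path through the piece: only finitely
   many pieces contain the edge from u to the latter, so the former is
     determined
   by it up to finitely many choices.  This bounds reach by induction on n. *)
Let reach (u : V) (v : V + W) (n K : nat) : set V :=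
  [set y | e u y /\ exists z q, [/\ walk e' [set~ inl u] n z v, shadow z q
                                  & walk e [set~ u] K y q]].

Lemma attach_reach_finite u v n K : finite_set (reach u v n K).
Proof.
have detour_fin := (fine_graphP e).1 efine.
elim: n K => [|n IH] K.
  apply: (@sub_finite_set _ _ (\bigcup_(q in shadow v) detour e u q K)).
    by move=> y [uy [z [q [[_ <-] zq yq]]]]; exists q.
  apply: bigcup_finite => // {detour_fin}; case: v => [x|w] /=.
    exact: finite_set1.
  exact: fill_fin.
pose turn := \bigcup_(y2 in reach u v n L)
  \bigcup_(i in [set i | fill i u /\ fill i y2])
  \bigcup_(y1 in fill i) detour e u y1 (K + L).
apply: (@sub_finite_set _ _ (reach u v n (K + L).+1 `|` turn)); last first.
  rewrite finite_setU; split=> //; apply: bigcup_finite => // y2 [uy2 _].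
  apply: bigcup_finite; first exact: fill_edge.
  by move=> i _; apply: bigcup_finite.
move=> y [uy [z [q [[zu st] zq yq]]]].
have qu : q <> u := walk_dst yq.
have mono K' q' : (K' <= (K + L).+1)%N -> walk e [set~ u] K' y q' ->
    walk e [set~ u] (K + L).+1 y q'.
  by move=> KK; exact: walk_mono.
case: st => [zv|[z' zz' z'v]].
  left; split=> //; exists z, q; split=> //.
    by rewrite zv; apply: walk_refl; rewrite -zv.
  by apply: mono yq; lia.
have step q' K' : shadow z' q' -> (K' <= (K + L).+1)%N ->
    walk e [set~ u] K' y q' -> (reach u v n (K + L).+1 `|` turn) y.
  by move=> zq' KK yq'; left; split=> //; exists z', q'; split=> //;
    apply: mono yq'.
case: z z' zq zu zz' z'v step => [x|w] [x'|w'] /= zq zu zz' z'v step.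
- have x'u : x' <> u by move=> x'u; apply: (walk_src z'v); rewrite x'u.
  rewrite zq in yq qu; apply: (step x' K.+1) => //; first by lia.
  rewrite -addn1; apply: (walk_cat yq); apply: walk1 => //.
  by rewrite -eVV.
- by apply: (step q K) => //; [rewrite zq; exact: eVW|lia].
- rewrite es' in zz'; have fx' := eVW zz'; set i := kappa w in zq fx'.
  have x'u : x' <> u by move=> x'u; apply: (walk_src z'v); rewrite x'u.
  have sub : fill i `&` [set~ u] `<=` [set~ u] by move=> ? [].
  case: (walk_hit qu (fill_conn zq fx')) => [qx'|[y1 [y1u iu qy1]]].
    apply: (step x' (K + L)%N) => //; apply: (walk_cat yq).
    by apply: walk_mono qx'.
  (* The neighbour of [u] on the side of [x'] is found by walking backwards from [x'] and stopping
     at the first visit to [u]. *)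
  case: (walk_hit x'u (fill_conn fx' zq)) => [x'q|[y2 [y2u _ x'y2]]].
    apply: (step x' (K + L)%N) => //; apply: (walk_cat yq).
    by apply: walk_mono (walk_sym es x'q).
  right; exists y2.
    split; first by rewrite es.
    exists (inl x'), x'; split=> //.
    by apply: walk_mono (walk_sym es x'y2).
  exists i; first by split=> //; case: (walk_dst x'y2).
  exists y1; first by case: (walk_dst qy1).
  by split=> //; apply: (walk_cat yq); apply: walk_mono qy1.
- by apply: (step q K) => //; [rewrite -(eWW zz')|lia].
Qed.

(** A new vertex has finitely many neighbours. At an old vertex [u], old neighbours lie in [reach].
    If the piece of a new neighbour has a [fill] point other than [u], then that [fill] contains an
    edge from [u] to a vertex of [reach], which leaves finitely many pieces. Otherwise the walk
    cannot leave the piece without meeting [u], so [v] lies in the same piece. *)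
Lemma attach_fine : fine_graph e'.
Proof.
apply/fine_graphP => -[u|w] v n; last first.
  apply: (@sub_finite_set _ _ ((inl @` fill (kappa w)) `|`
      (inr @` [set w' | kappa w' = kappa w]))).
    move=> [x|w'] [wy _].
      by left; exists x => //; apply: eVW; rewrite es'.
    by right; exists w' => //=; rewrite -(eWW wy).
  by rewrite finite_setU; split; apply: finite_image.
pose fibers i : set (V + W) := inr @` [set w | kappa w = i].
have fib i : finite_set (fibers i) by apply: finite_image.
have rfin := attach_reach_finite u v n 0.
apply: (@sub_finite_set _ _ ((inl @` reach u v n 0) `|`
  (\bigcup_(y in reach u v n 0)
     \bigcup_(i in [set i | fill i u /\ fill i y]) fibers i) `|`
  (if v is inr w then fibers (kappa w) else set0))); last first.
  rewrite !finite_setU; split; first split.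
  - exact: finite_image.
  - apply: bigcup_finite => // y [uy _]; apply: bigcup_finite => //.
    exact: fill_edge.
  - by case: (v) => [x|w]; [exact: finite_set0|].
move=> [y|w] [uy yv].
  left; left; exists y => //; split; first by rewrite -eVV.
  exists (inl y), y; split=> //; apply: walk_refl => yu.
  by apply: (walk_src yv); rewrite yu.
have iu := eVW uy.
have [[q iq qu]|none] := pselect (exists2 q, fill (kappa w) q & q <> u).
  have sub : fill (kappa w) `&` [set~ u] `<=` [set~ u] by move=> ? [].
  case: (walk_hit qu (fill_conn iq iu)) => [qq|[y [yu _ qy]]].
    by have [_ /(_ erefl)] := walk_dst qq.
  have [iy yu'] := walk_dst qy.
  left; right; exists y.
    split; first by rewrite es.
    by exists (inr w), y; split=> //; exact: walk_refl.
  by exists (kappa w) => //; exists w.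
right.
have stay m w1 : kappa w1 = kappa w -> walk e' [set~ inl u] m (inr w1) v ->
    exists2 w2, v = inr w2 & kappa w2 = kappa w.
  elim: m w1 => [|m IH] w1 kw1 /= [_]; first by move=> <-; exists w1.
  case=> [<-|[[x|w2] w12 w2v]]; first by exists w1.
    exfalso; apply: none; exists x; first by rewrite -kw1; apply: eVW;
      rewrite es'.
    by move=> xu; apply: (walk_src w2v); rewrite xu.
  by apply: IH w2v; rewrite -kw1; apply/esym/eWW.
by have [w2 -> kw2] := stay n w erefl yv; exists w.
Qed.

End AttachFine.

(** * Topological groups *)

(** If the image were infinite, removing the fibres over finite sets of values from [K] would
    generate a proper filter; a neighbourhood on which [f] is constant shows that no point of [K] is
    a cluster point of it. *)
Lemma compact_locally_constant (T : topologicalType) (U : Type) (f : T -> U)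
    (K : set T) :
  compact K -> (forall x, K x -> nbhs x [set y | f y = f x]) ->
  finite_set (f @` K).
Proof.
move=> cK fK; apply: contrapT => inf.
pose F : set_system T :=
  [set S | exists2 D : set U, finite_set D & K `\` f @^-1` D `<=` S].
have FF : ProperFilter F.
  split.
    case=> D finD KD; apply: inf; apply: (sub_finite_set _ finD).
    move=> _ [x Kx <-]; apply: contrapT => nD; exact: (KD x).
  split.
  - by exists set0.
  - move=> P Q [D fD DP] [E fE EQ]; exists (D `|` E).
      by rewrite finite_setU.
    by move=> x [Kx nDE]; split; [apply: DP|apply: EQ]; split=> // ?;
       apply: nDE; [left|right].
  - by move=> P Q PQ [D fD DP]; exists D => //; apply: subset_trans DP _.
have FK : F K by exists set0 => // x [].
have [x [Kx clx]] := cK F FF FK.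
have [y [[Ky ny] yx]] :
    (K `\` f @^-1` [set f x]) `&` [set y | f y = f x] !=set0.
  by apply: clx; [exists [set f x]|exact: fK].
by apply: ny.
Qed.

Section GroupMorphism.
Variables (G H : groupType) (f : {multiplicative G -> H}).
Local Open Scope group_scope.

Lemma gmulf1g : f 1 = 1.
Proof. by apply: (@mulgI _ (f 1)); rewrite -gmulfM !mulg1. Qed.

Lemma gmulfV x : f x^-1 = (f x)^-1.
Proof. by apply/esym/mulg1_eq; rewrite -gmulfM mulgV gmulf1g. Qed.

Lemma gmulfJ x y : f (x ^ y) = f x ^ f y.
Proof. by rewrite !conjgE !gmulfM gmulfV. Qed.

End GroupMorphism.

Section Subgroup.
Variables (G : groupType) (H : set G).
Local Open Scope group_scope.
Hypothesis sH : subgroup H.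

Lemma subgroup1 : H 1. Proof. by case: sH. Qed.

Lemma subgroupV x : H x -> H x^-1.
Proof. by rewrite -(mul1g x^-1) => Hx; apply: sH.2 => //; case: sH. Qed.

Lemma subgroupM x y : H x -> H y -> H (x * y).
Proof. by rewrite -{2}(invgK y) => Hx Hy; apply: sH.2 => //;
  exact: subgroupV. Qed.

Lemma subgroupMl x y : H x -> H (x * y) <-> H y.
Proof.
move=> Hx; split; last exact: subgroupM.
by move=> Hxy; rewrite -(mulKg x y); apply: subgroupM => //; exact: subgroupV.
Qed.

Lemma subgroupMr x y : H y -> H (x * y) <-> H x.
Proof.
move=> Hy; split; last by move=> Hx; exact: subgroupM.
by move=> Hxy; rewrite -(mulgK y x); apply: subgroupM => //; exact: subgroupV.
Qed.

End Subgroup.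

Section TopologicalGroup.
Variable G : topologicalGroupType.
Implicit Types (a g x : G) (H K : set G).
Local Open Scope group_scope.

Lemma mulgl_continuous a : continuous (fun x : G => a * x).
Proof.
move=> x; apply: (@continuous_comp _ _ _ (fun x => (a, x))
  (fun z : G * G => z.1 * z.2)); last exact: mulg_continuous.
by apply: cvg_pair; [exact: cvg_cst|exact: cvg_id].
Qed.

Lemma mulgr_continuous a : continuous (fun x : G => x * a).
Proof.
move=> x; apply: (@continuous_comp _ _ _ (fun x => (x, a))
  (fun z : G * G => z.1 * z.2)); last exact: mulg_continuous.
by apply: cvg_pair; [exact: cvg_id|exact: cvg_cst].
Qed.

Lemma conjg_continuous a : continuous (fun x : G => x ^ a).
Proof.
move=> x; rewrite (_ : (fun x => _) = (fun x : G => a^-1 * x) \o (fun x => x *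
  a)).
  by apply: continuous_comp; [exact: mulgr_continuous|exact: mulgl_continuous].
by apply/funext => y /=; rewrite conjgE.
Qed.

Lemma open_mulgl a H : open H -> open [set x | H (a * x)].
Proof. by move=> oH; apply: open_comp oH => x _; exact: mulgl_continuous. Qed.

Lemma open_conjg a H : open H -> open [set x | H (x ^ a)].
Proof. by move=> oH; apply: open_comp oH => x _; exact: conjg_continuous. Qed.

Section OpenSubgroup.
Variable H : set G.
Hypotheses (sH : subgroup H) (oH : open H).

Lemma nbhs_lcoset x : nbhs x [set y | H (x^-1 * y)].
Proof.
apply: open_nbhs_nbhs; split; first exact: open_mulgl.
by rewrite /= mulVg; exact: (subgroup1 sH).
Qed.

Lemma open_supergroup K : subgroup K -> H `<=` K -> open K.
Proof.
move=> sK HK; rewrite openE => x Kx; rewrite /interior.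
apply: filterS (nbhs_lcoset x) => y /= /HK Hxy.
by rewrite -(mulVKg x y); exact: subgroupM.
Qed.

Lemma open_subgroup_closed : closed H.
Proof.
move=> x clx; have [y [Hy /= xy]] := clx _ (nbhs_lcoset x).
by rewrite -(invgK x); apply: subgroupV => //; apply/(subgroupMr sH _ Hy).
Qed.

End OpenSubgroup.

Lemma compact_conjg g H : compact H -> compact [set x ^ g | x in H].
Proof.
apply: continuous_compact; apply: continuous_subspaceT.
exact: conjg_continuous.
Qed.

End TopologicalGroup.

(** * Open embeddings of spaces and of topological groups *)

Section OpenEmbedding.
Variables (S T : topologicalType) (f : S -> T).
Hypothesis ef : open_embedding f.

Lemma open_embedding_nbhs x U : nbhs x U -> nbhs (f x) (f @` U).
Proof.
case: ef => _ _ of_; rewrite nbhsE => -[P [oP Px] PU].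
apply: filterS (open_nbhs_nbhs (conj (of_ _ oP) _)); first exact: image_subset.
by exists x.
Qed.

Lemma open_embedding_compact K : compact K -> compact (f @` K).
Proof.
by case: ef => _ cf _; apply: continuous_compact; exact: continuous_subspaceT.
Qed.

Lemma open_embedding_compact_inv K : compact (f @` K) -> compact K.
Proof.
case: ef => injf _ _ cK F FF FK.
have [|_ [[x Kx <-] clx]] := cK (f @ F) _.
  by apply: (@filterS _ F _ K) FK => x Kx; exists x.
exists x; split=> // A B FA Bx.
have [_ [[a Aa <-] [b Bb /injf ab]]] : f @` A `&` f @` B !=set0.
  apply: clx; last exact: open_embedding_nbhs.
  by apply: (@filterS _ F _ A) FA => a Aa; exists a.
by exists a; split=> //; rewrite -ab.
Qed.

Lemma open_embedding_cluster x y :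
  cluster (nbhs (f x)) (f y) -> cluster (nbhs x) y.
Proof.
case: ef => injf _ _ cl A B Ax By.
have [_ [[a Aa <-] [b Bb /injf ab]]] :=
  cl _ _ (open_embedding_nbhs Ax) (open_embedding_nbhs By).
by exists a; split=> //; rewrite -ab.
Qed.

Lemma open_embedding_connected D :
  connected D -> D `<=` range f -> connected (f @^-1` D).
Proof.
case: ef => injf cf of_ cD Df B [b Bb] [P oP BP] [C cC BC].
have fB : f @` B = D `&` f @` P.
  apply/seteqP; split=> [_ [x Bx <-]|y [Dy [x Px xy]]].
    by move: Bx; rewrite BP => -[/= Dx Px]; split=> //; exists x.
  by exists x => //; rewrite BP; split=> //=; rewrite xy.
(* The image of the closed set [C] need not be closed, so the image of its open complement is
   removed instead. *)
have fB' : f @` B = D `&` ~` (f @` ~` C).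
  apply/seteqP; split=> [_ [x Bx <-]|y [Dy nCy]].
    move: Bx; rewrite BC => -[/= Dx Cx]; split=> // -[z nCz /injf zx].
    by apply: nCz; rewrite zx.
  have [x _ xy] := Df y Dy; exists x => //; rewrite BC; split;
    rewrite /= ?xy //.
  by apply: contrapT => nCx; apply: nCy; exists x.
have fBD : f @` B = D.
  apply: cD; first by exists (f b), b.
    by exists (f @` P) => //; exact: of_.
  exists (~` (f @` ~` C)) => //; apply: open_closedC; apply: of_.
  exact: closed_openC.
apply/seteqP; split=> x; first by rewrite BP => -[].
by rewrite -{1}fBD => -[z Bz /injf <-].
Qed.

End OpenEmbedding.

Section Embedding.
Variables (A G : topologicalGroupType) (J : {multiplicative A -> G}).
Hypothesis eJ : open_embedding J.
Local Open Scope group_scope.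

Lemma open_embedding_mulgl p : open_embedding (fun x => p * J x).
Proof.
case: eJ => injJ cJ oJ; split.
- by move=> x y /mulgI /injJ.
- move=> x; apply: (@continuous_comp _ _ _ J (fun y => p * y)); first exact: cJ.
  exact: mulgl_continuous.
- move=> U oU.
  rewrite (_ : _ @` _ = [set x | (J @` U) (p^-1 * x)]).
    by apply: open_mulgl; exact: oJ.
  apply/seteqP; split=> [_ [x Ux <-]|y [x Ux xy]] /=.
    by rewrite mulKg; exists x.
  by exists x => //; rewrite xy mulVKg.
Qed.

Lemma range_subgroup : subgroup (range J).
Proof.
split; first by exists 1 => //; exact: gmulf1g.
move=> _ _ [x _ <-] [y _ <-]; exists (x / y) => //; apply: (@mulIg _ (J y)).
by rewrite -gmulfM !mulgVK.
Qed.

Lemma image_open_subgroup H : open_subgroup H -> open_subgroup (J @` H).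
Proof.
move=> [sH oH]; split; last by case: eJ => _ _; exact.
split; first by exists 1; [exact: subgroup1|exact: gmulf1g].
move=> _ _ [x Hx <-] [y Hy <-]; exists (x / y); last by rewrite gmulfM gmulfV.
by apply: sH.2.
Qed.

Lemma range_open : open (range J).
Proof. by case: eJ => _ _; apply; exact: openT. Qed.

Lemma nbhs_range_lcoset p : nbhs p (range (fun x => p * J x)).
Proof.
rewrite -[X in nbhs X _]mulg1 -(gmulf1g J).
by apply: (open_embedding_nbhs (open_embedding_mulgl p)); exact: filterT.
Qed.

Lemma clopen_range_lcoset p : clopen (range (fun x => p * J x)).
Proof.
rewrite (_ : range _ = [set x | range J (p^-1 * x)]); last first.
  apply/seteqP; split=> [_ [x _ <-]|y [x _ xy]] /=; first by rewrite mulKg;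
    exists x.
  by exists x => //; rewrite xy mulVKg.
split; first by apply: open_mulgl; exact: range_open.
apply: closed_comp; last by apply: open_subgroup_closed range_open;
  exact: range_subgroup.
by move=> x _; exact: mulgl_continuous.
Qed.

(** Two inseparable points have meeting open cosets, hence lie in one coset, which is a copy of
    [A]. *)
Lemma hausdorff_embedding : hausdorff_space A -> hausdorff_space G.
Proof.
move=> hA p q cl.
have [_ [[x _ <-] [y _ yx]]] := cl _ _ (nbhs_range_lcoset p) (nbhs_range_lcoset
  q).
have eq : q = p * J (x / y).
  apply: (@mulIg _ (J y)); rewrite yx -mulgA -gmulfM mulgVK //.
suff xy : 1 = x / y by rewrite eq -xy gmulf1g mulg1.
apply: hA; apply: (open_embedding_cluster (open_embedding_mulgl p)).
by rewrite gmulf1g mulg1 -eq.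
Qed.

(** Cosets of [A] are clopen, so a connected set lies in one coset and is a point; a translate of a
    compact neighbourhood of 1 in [A] gives local compactness. *)
Lemma tdlc_embedding : tdlc A -> tdlc G.
Proof.
case=> hA tA lA; have hG := hausdorff_embedding hA; split=> //.
- move=> x _; apply/seteqP; split=> [y [D [Dx _ cD] Dy]|_ ->]; last first.
    by exists [set x] => //; split=> //; exact: connected1.
  pose f a := x * J a; have ef := open_embedding_mulgl x.
  have [oR cR] := clopen_range_lcoset x.
  have f1 : f 1 = x by rewrite /f gmulf1g mulg1.
  have DR : D `&` range f = D.
    apply: cD; last by exists (range f).
      by exists x; split=> //; exists 1.
    by exists (range f).
  have DR' : D `<=` range f by rewrite -DR => ? [].
  have [a _ ay] := DR' _ Dy.
  have : connected_component [set: A] 1 a.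
    exists (f @^-1` D); last by rewrite /= ay.
    split=> //; first by rewrite /= f1.
    exact: (open_embedding_connected ef).
  by rewrite tA // => a1; rewrite -ay /= a1.
- move=> x _; have [U wU [cU _]] := lA 1 I.
  have cf := open_embedding_compact (open_embedding_mulgl x) cU.
  exists ((fun a => x * J a) @` U); last by split=> //; exact: compact_closed.
  have U1 : nbhs (1 : A) U by apply: (@filterS _ (nbhs (1 : A)) _ _ _ _ wU) =>
    y; exact.
  have := open_embedding_nbhs (open_embedding_mulgl x) U1.
  rewrite gmulf1g mulg1 => xU.
  by apply: (@filterS _ (nbhs x) _ _ _ _ xU) => y.
Qed.

End Embedding.

(** * Amalgams *)

Section FunctionSemidirect.
Variable G : groupType.
Local Open Scope group_scope.

(** The semidirect product of the Z/2-valued functions on [G], added by [addb], with [G] acting by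
    left translation. *)
Definition fsemi : Type := ((G -> bool) * G)%type.

HB.instance Definition _ := gen_eqMixin fsemi.

HB.instance Definition _ := gen_choiceMixin fsemi.

Definition fsemi_one : fsemi := (fun=> false, 1).

Definition fsemi_inv (p : fsemi) : fsemi := (fun x => p.1 (p.2 * x), p.2^-1).

Definition fsemi_mul (p q : fsemi) : fsemi :=
  (fun x => p.1 x (+) q.1 (p.2^-1 * x), p.2 * q.2).

Lemma fsemi_mulA : associative fsemi_mul.
Proof.
move=> [m g] [n h] [k l]; congr pair => /=; last exact: mulgA.
by apply/funext => x /=; rewrite invgM mulgA addbA.
Qed.

Lemma fsemi_mul1 : left_id fsemi_one fsemi_mul.
Proof.
by move=> [m g]; congr pair; rewrite /= ?mul1g //; apply/funext => x /=;
  rewrite invg1 mul1g.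
Qed.

Lemma fsemi_mulr1 : right_id fsemi_one fsemi_mul.
Proof.
by move=> [m g]; congr pair; rewrite /= ?mulg1 //; apply/funext => x /=;
  rewrite addbF.
Qed.

Lemma fsemi_mulV : left_inverse fsemi_one fsemi_inv fsemi_mul.
Proof.
move=> [m g]; congr pair; rewrite /= ?mulVg //; apply/funext => x /=.
by rewrite invgK addbb.
Qed.

Lemma fsemi_mulrV : right_inverse fsemi_one fsemi_inv fsemi_mul.
Proof.
move=> [m g]; congr pair; rewrite /= ?mulgV //; apply/funext => x /=.
by rewrite mulVKg addbb.
Qed.

HB.instance Definition _ :=
  isGroup.Build fsemi fsemi_mulA fsemi_mul1 fsemi_mulr1 fsemi_mulV fsemi_mulrV.

Lemma fsemiM (p q : fsemi) : p * q = fsemi_mul p q. Proof. by []. Qed.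

Variables (H : groupType) (f : {multiplicative H -> G}) (m : G -> bool).

Definition fsemi_pair0 (x : H) : fsemi := (fun=> false, f x).

Lemma fsemi_pair0_morph : {morph fsemi_pair0 : x y / x * y}.
Proof. by move=> x y; rewrite fsemiM /fsemi_mul /= /fsemi_pair0 gmulfM. Qed.

HB.instance Definition _ :=
  isMultiplicative.Build H fsemi fsemi_pair0 fsemi_pair0_morph.

(* The conjugate of [fsemi_pair0] by (m, 1). *)
Definition fsemi_pair1 (x : H) : fsemi :=
  (fun y => m y (+) m ((f x)^-1 * y), f x).

Lemma fsemi_pair1_morph : {morph fsemi_pair1 : x y / x * y}.
Proof.
move=> x y; rewrite fsemiM /fsemi_mul /= /fsemi_pair1 gmulfM; congr pair.
by apply/funext => z; rewrite invgM -!mulgA addbA addbK.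
Qed.

HB.instance Definition _ :=
  isMultiplicative.Build H fsemi fsemi_pair1 fsemi_pair1_morph.

End FunctionSemidirect.

Section Amalgam.
Variables (A B C G : groupType).
Variables (iA : {multiplicative C -> A}) (iB : {multiplicative C -> B})
          (jA : {multiplicative A -> G}) (jB : {multiplicative B -> G}).
Hypothesis am : is_amalgam iA iB jA jB.
Local Open Scope group_scope.

Lemma amalgam_ext (T : groupType) (h h' : {multiplicative G -> T}) :
  h \o jA =1 h' \o jA -> h \o jB =1 h' \o jB -> h =1 h'.
Proof.
case: am => ij univ hA hB.
have /univ [k [_ _ uniq]] : (h' \o jA) \o iA =1 (h' \o jB) \o iB.
  by move=> c /=; congr (h' _); exact: ij.
by move=> x; rewrite (uniq h) // (uniq h').
Qed.

(* Both homomorphisms g |-> (0, g) and g |-> (m - g m, g), with m the indicator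
   of the subgroup generated by A and B, agree on A and on B. *)
Lemma amalgam_ind (P : set G) :
  P 1 -> (forall g a, P g -> P (g * jA a)) ->
  (forall g b, P g -> P (g * jB b)) -> forall g, P g.
Proof.
move=> P1 PA PB.
pose closed_mul (Q : set G) := [/\ Q 1, forall g a, Q g -> Q (g * jA a)
  & forall g b, Q g -> Q (g * jB b)].
pose H : set G := [set g | forall Q, closed_mul Q -> Q g].
pose m g := `[< H g >].
have HA a g : H g -> H (jA a * g).
  move=> Hg Q [Q1 QA QB]; apply: (Hg [set x | Q (jA a * x)]); split=> /=.
  - by rewrite mulg1 -[jA a]mul1g; exact: QA.
  - by move=> x b; rewrite mulgA; exact: QA.
  - by move=> x b; rewrite mulgA; exact: QB.
have HB b g : H g -> H (jB b * g).
  move=> Hg Q [Q1 QA QB]; apply: (Hg [set x | Q (jB b * x)]); split=> /=.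
  - by rewrite mulg1 -[jB b]mul1g; exact: QB.
  - by move=> x a; rewrite mulgA; exact: QA.
  - by move=> x a; rewrite mulgA; exact: QB.
have eqh : fsemi_pair0 (@idfun G) =1 fsemi_pair1 (@idfun G) m.
  apply: amalgam_ext => x /=; rewrite /fsemi_pair0 /fsemi_pair1; congr pair;
      apply/funext => y /=; apply/esym; rewrite -gmulfV.
    suff -> : m (jA x^-1 * y) = m y by rewrite addbb.
    apply/asboolP/asboolP => [/(HA x)|/(HA x^-1)//].
    by rewrite gmulfV mulVKg.
  suff -> : m (jB x^-1 * y) = m y by rewrite addbb.
  apply/asboolP/asboolP => [/(HB x)|/(HB x^-1)//].
  by rewrite gmulfV mulVKg.
move=> g; suff : H g by apply.
have H1 : H 1 by move=> Q [].
have /= := congr1 (fun p : fsemi G => p.1 g) (eqh g).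
rewrite mulVg (_ : m 1 = true); last by apply/asboolP.
by rewrite addbT => /esym/negbFE/asboolP.
Qed.

(* The homomorphism extending a |-> (0, a) and b |-> (m - b m, b), with m the
   indicator of C, yields a cocycle D; [side g true] is D g at 1, and
   [side g false] is D g + g m at 1. *)
Lemma amalgam_side : exists side : G -> bool -> bool,
  [/\ forall g a, side (g * jA a) true = side g true,
      forall g b, side (g * jB b) false = side g false
    & forall g, side g true (+) side g false = `[< range (jA \o iA) g >] ].
Proof.
case: (am) => ij univ; pose m g := `[< range (jA \o iA) g >].
have rM x y : range (jA \o iA) x -> range (jA \o iA) y -> range (jA \o iA) (x *
  y).
  by move=> [c _ <-] [d _ <-]; exists (c * d) => //=; rewrite !gmulfM.
have rV x : range (jA \o iA) x -> range (jA \o iA) x^-1.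
  by move=> [c _ <-]; exists c^-1 => //=; rewrite !gmulfV.
have mM x y : range (jA \o iA) x -> m (x * y) = m y.
  move=> rx; apply/asboolP/asboolP => [/(rM _ _ (rV _ rx))|]; last exact: rM.
  by rewrite mulKg.
have [|h [hA hB _]] := univ _ (fsemi_pair0 jA) (fsemi_pair1 jB m).
  move=> c; rewrite /= /fsemi_pair0 /fsemi_pair1; congr pair; last exact: ij.
  apply/funext => y; apply/esym.
  rewrite mM ?addbb //; apply: rV; exists c => //; exact: ij.
have h2 g : (h g).2 = g.
  pose p (x : fsemi G) : G := x.2.
  have pM : {morph p : x y / x * y} by [].
  pose pm := isMultiplicative.Build _ _ p pM.
  pose pp : {multiplicative fsemi G -> G} := HB.pack p pm.
  apply: (amalgam_ext (h := pp \o h) (h' := @idfun G)) => x /=.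
    by rewrite [h _]hA.
  by rewrite [h _]hB.
exists (fun g b => if b then (h g).1 1 else (h g).1 1 (+) m g^-1); split.
- by move=> g a; rewrite gmulfM fsemiM [h (jA a)]hA /= addbF.
- move=> g b; rewrite gmulfM fsemiM [h (jB b)]hB /= h2 mulg1 invgM.
  by rewrite -!addbA addbb addbF.
- move=> g; rewrite addKb; apply/asboolP/asboolP => /rV //.
  by rewrite invgK.
Qed.

End Amalgam.

(** * Separation by edges of the Bass-Serre tree *)

Section Gates.
Variables (G : groupType) (K : bool -> groupType).
Variables (J : forall b, {multiplicative K b -> G}) (S : set G).
Variable side : G -> bool -> bool.
Local Open Scope group_scope.
Hypotheses (sS : subgroup S) (SJ : forall b, S `<=` range (J b))
  (ind : forall P : set G, P 1 -> (forall b g a, P g -> P (g * J b a)) ->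
     forall g, P g)
  (side_J : forall b g a, side (g * J b a) b = side g b)
  (side_S : forall g, side g true (+) side g false = `[< S g >]).

Lemma side_neg g b : side g (~~ b) = side g b (+) `[< S g >].
Proof. by rewrite -side_S; case: b;
  rewrite /= ?addKb // addbC -addbA addbb addbF. Qed.

(* [side g c] is the side of the edge S of the Bass-Serre tree on which its
   vertex g K_c lies; far: the edge aS separates that vertex from K_b. *)
Definition far b (a g : G) c := side (a^-1 * g) c != side 1 b.

Lemma farM b a g c k : far b a (g * J c k) c = far b a g c.
Proof. by rewrite /far mulgA side_J. Qed.

Lemma far_piece b a k : range (J b) a -> far b a (J b k) b = false.
Proof. by case=> l _ <-;
  rewrite /far -gmulfV -gmulfM -[J b _]mul1g side_J eqxx. Qed.

(** The vertex of [b] is on the near side, and crossing the bridge at [J b k] changes sides exactly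
    when that bridge is the edge aS. *)
Lemma far_neg b a k : range (J b) a -> far b a (J b k) (~~ b) = `[< S (a^-1 * J
  b k) >].
Proof.
move=> ra; have := far_piece k ra; rewrite /far side_neg => /negbFE /eqP ->.
by case: (side 1 b); case: `[< _ >].
Qed.

(** The bridge at [g] is not the edge aS, because aS lies in the range of [J b] and [g] does not; so
    its two ends are on the same side. *)
Lemma far_bridge b a g c : range (J b) a -> ~ range (J b) g ->
  far b a g (~~ c) = far b a g c.
Proof.
move=> [l _ <-] ng; rewrite /far side_neg (_ : `[< _ >] = false) ?addbF //.
apply/negbTE/negP => /asboolP /(SJ b) [k _ Jk]; apply: ng; exists (l * k) => //.
by rewrite gmulfM Jk mulVKg.
Qed.

Definition in_piece b g c := c = b /\ range (J b) g.

Lemma in_pieceM b g c k : in_piece b (g * J c k) c <-> in_piece b g c.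
Proof.
split=> -[cb]; subst c.
  move=> [l _ gl]; split=> //; exists (l * k^-1) => //.
  by rewrite gmulfM gl gmulfV mulgK.
by move=> [l _ <-]; split=> //; exists (l * k) => //; rewrite gmulfM.
Qed.

(* Among the coset edges aS at the vertex of b, exactly one separates it from
   any other vertex of the Bass-Serre tree. *)
Lemma gate_exists b g c : ~ in_piece b g c ->
  exists a, forall a', far b (J b a') g c <-> S (J b (a^-1 * a')).
Proof.
have Sinv x : S x -> S x^-1 by exact: subgroupV.
pose P g c := ~ in_piece b g c ->
  exists a, forall a', far b (J b a') g c <-> S (J b (a^-1 * a')).
(* Crossing the bridge at [h]: if it touches the vertex of [b], it is itself the separating edge;
   otherwise [far] does not change and the old gate remains. *)
have bridge h d : P h d -> P h (~~ d).
  move=> Phd npi; have [[k _ hk]|nh] := pselect (range (J b) h).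
    exists k => a'; have -> : ~~ d = ~~ b.
      by case: d b npi {P Phd} k hk a' => -[] // npi k hk; case: npi;
        split=> //; exists k.
    rewrite -hk far_neg; last by exists a'.
    have -> : S (J b (k^-1 * a')) <-> S ((J b a')^-1 * J b k).
      by rewrite gmulfM gmulfV; split=> /Sinv; rewrite invgM invgK.
    by split=> [/asboolP|?]; [|exact/asboolP].
  have [|a aP] := Phd; first by case.
  by exists a => a'; rewrite far_bridge //; exists a'.
have both h d : P h d -> forall d', P h d'.
  by move=> Phd d'; have := bridge h d Phd; case: d d' Phd => -[].
suff : forall d, P g d by apply.
(* Induction on words: right multiplication by an element of K_d does not move the vertex g K_d, and
   bridges pass between the two vertices of the same [g]. *)
move: g {c}; apply: ind => [|d g a Pg].
  by apply: (both _ b); case; split=> //; exists 1; rewrite ?gmulf1g.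
apply: (both _ d) => npi; have [|k kP] := Pg d;
  first by rewrite -(in_pieceM b g a).
by exists k => a'; rewrite farM.
Qed.

(** An element fixing both the vertex of [b] and g K_c sends the gate of g K_c to a gate of it, and
    there is only one. *)
Lemma gate_fixed b g c : ~ in_piece b g c ->
  exists a, forall k, range (J c) (g^-1 * (J b k * g)) -> S (J b (a^-1 * (k *
    a))).
Proof.
move=> /gate_exists [a aP]; exists a => k [l _ lk]; apply/aP.
rewrite -(farM _ _ _ l) lk mulVKg gmulfM /far invgM -mulgA mulKg -/(far b _ g
  c).
by apply/aP; rewrite mulVg gmulf1g; exact: subgroup1.
Qed.

(** The elements of [H] fix two vertices of the Bass-Serre tree. If these are distinct, [H] fixes
    the first edge between them, whose stabilizer is a conjugate of [S]. *)
Lemma two_pieces b g c (H : set G) : H `<=` range (J b) ->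
  (forall h, H h -> range (J c) (h ^ g)) ->
  in_piece b g c \/ exists k, H `<=` [set s ^ k | s in S].
Proof.
move=> Hb Hc; have [|/gate_fixed [a aP]] := pselect (in_piece b g c);
  first by left.
right; exists (J b a)^-1 => h Hh; have [k _ kh] := Hb h Hh.
have := Hc h Hh; rewrite -kh conjgE => /aP Sk.
exists (J b (a^-1 * (k * a))) => //.
by rewrite conjgE !gmulfM gmulfV invgK !mulgA mulgV mul1g mulgK.
Qed.

End Gates.

(** * Graph actions *)

Section Stabilizers.
Local Open Scope group_scope.
Variables (G : groupType) (V : choiceType) (e : rel V) (act : G -> V -> V).
Hypothesis actP : graph_action e act.

Lemma graph_actK g : cancel (act g) (act g^-1).
Proof. by case: actP => a1 aM _ v; rewrite -aM mulVg a1. Qed.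

Lemma vertex_stab_subgroup v : subgroup (vertex_stab act v).
Proof.
case: actP => a1 aM _; split; first exact: a1.
by rewrite /vertex_stab => x y /= xv yv; rewrite aM -{1}yv graph_actK.
Qed.

Lemma vertex_stab_act g v :
  vertex_stab act (act g v) = [set y ^ g^-1 | y in vertex_stab act v].
Proof.
case: actP => a1 aM _; rewrite /vertex_stab.
apply/seteqP; split=> [h /= hgv|_ [y /= yv <-]].
  exists (h ^ g); last by rewrite conjgK.
  by rewrite /= conjgE !aM hgv graph_actK.
by rewrite conjgE invgK !aM graph_actK yv.
Qed.

Lemma edge_stab_subgroup u v : subgroup (edge_stab act u v).
Proof.
case: actP => a1 aM _; split; rewrite /edge_stab /=.
  by rewrite image_setU !image_set1 !a1.
move=> x y xuv yuv; rewrite -[in RHS]xuv -[X in act (x / y) @` X]yuv.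
apply/seteqP; split=> [_ [_ [z zuv <-] <-]|_ [z zuv <-]] /=.
  by exists z; rewrite // aM graph_actK.
by exists (act y z); [exists z|rewrite aM graph_actK].
Qed.

Lemma edge_pstab_stab u v : edge_pstab act u v `<=` edge_stab act u v.
Proof. by move=> g [gu gv];
  rewrite /edge_stab /= image_setU !image_set1 gu gv. Qed.

Lemma walk_act (D : set V) g n u v :
  walk e D n u v -> walk e (act g @` D) n (act g u) (act g v).
Proof.
case: actP => _ _ ae; elim: n u => [|n IH] u /=.
  by case=> Du <-; split=> //; exists u.
case=> Du [<-|[w uw /IH wv]]; (split; first by exists u); first by left.
by right; exists (act g w); rewrite // ae.
Qed.

End Stabilizers.

(** * The tree of graphs *)

Section TreeOfGraphs.
Variables (G : groupType) (K : bool -> groupType).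
Variables (J : forall b, {multiplicative K b -> G}) (S : set G).
Variable side : G -> bool -> bool.
Local Open Scope group_scope.
Hypotheses (Jinj : forall b, injective (J b))
  (sS : subgroup S) (SJ : forall b, S `<=` range (J b))
  (ind : forall P : set G, P 1 -> (forall b g a, P g -> P (g * J b a)) ->
     forall g, P g)
  (side_J : forall b g a, side (g * J b a) b = side g b)
  (side_S : forall g, side g true (+) side g false = `[< S g >]).
Variables (V : bool -> choiceType) (e : forall b, rel (V b)).
Variables (act : forall b, K b -> V b -> V b) (star : forall b, V b).
Hypotheses (conn : forall b, connected_simplicial_graph (@e b))
  (actP : forall b, graph_action (@e b) (@act b))
  (star_stab : forall b a, act a (star b) = star b <-> S (J b a)).

Let act1 b v : act (1 : K b) v = v.
Proof. by case: (actP b). Qed.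

Let actM b (a k : K b) v : act (a * k) v = act a (act k v).
Proof. by case: (actP b). Qed.

Let actK b (a : K b) : cancel (act a) (act a^-1).
Proof. by move=> v; rewrite -actM mulVg act1. Qed.

Let acte b (a : K b) u v : e (act a u) (act a v) = e u v.
Proof. by case: (actP b). Qed.

Definition prevertex := {b : bool & (G * V b)%type}.

Definition prevx (b : bool) (g : G) (x : V b) : prevertex :=
  Tagged (fun b => (G * V b)%type) (g, x).

(** The classes are the orbits of [K b] acting on pairs, so the quotient is the disjoint union over
    [b] of the balanced products of [G] and [V b] over [K b]. *)
Definition prevx_rel (p q : prevertex) : bool :=
  `[< exists a : K (tag p),
        q = prevx ((tagged p).1 * (J (tag p) a)^-1) (act a (tagged p).2) >].

Lemma prevx_rel_refl : reflexive prevx_rel.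
Proof.
by move=> [b [g x]]; apply/asboolP; exists 1;
  rewrite /= gmulf1g invg1 mulg1 act1.
Qed.

Lemma prevx_rel_sym : symmetric prevx_rel.
Proof.
suff sym p q : prevx_rel p q -> prevx_rel q p by move=> p q; apply/idP/idP;
  exact: sym.
case: p => [b [g x]] /asboolP [a /= ->]; apply/asboolP; exists a^-1 => /=.
by rewrite actK gmulfV invgK mulgVK.
Qed.

Lemma prevx_rel_trans : transitive prevx_rel.
Proof.
move=> _ [b [g x]] r /asboolP [a /= ->] /asboolP [k /= ->]; apply/asboolP.
by exists (k * a); rewrite /= gmulfM invgM actM mulgA.
Qed.

Canonical prevx_equiv := EquivRel prevx_rel prevx_rel_refl prevx_rel_sym
  prevx_rel_trans.

Definition tvertex : choiceType := {eq_quot prevx_equiv}%qT.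

(* The point g.x of the copy g X_b of X_b, with g.(a x) = (g a).x. *)
Definition vx (b : bool) (g : G) (x : V b) : tvertex := \pi_{eq_quot
  prevx_equiv}%qT (prevx g x).

Lemma vx_ind (P : tvertex -> Prop) : (forall b g x, P (@vx b g x)) -> forall v,
  P v.
Proof. by move=> Pvx v; elim/quotP: v => -[b [g x]] _; exact: Pvx. Qed.

Lemma vx_eqP b g x b' g' x' : @vx b g x = @vx b' g' x' <->
  exists a, prevx g' x' = prevx (g * (J b a)^-1) (act a x).
Proof.
split=> [/eqquotP /asboolP //|[a ax]].
by apply/eqquotP/asboolP; exists a.
Qed.

Lemma vx_eq_type b g x b' g' x' : @vx b g x = @vx b' g' x' -> b = b'.
Proof. by move=> /vx_eqP [a /(congr1 tag)]. Qed.

Lemma vx_eq b g x g' x' : @vx b g x = @vx b g' x' <->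
  exists a, g' = g * (J b a)^-1 /\ x' = act a x.
Proof.
split=> [/vx_eqP [a]|[a [-> ->]]]; last by apply/vx_eqP; exists a.
by move=> /eqP; rewrite eq_Tagged /= => /eqP [-> ->]; exists a.
Qed.

Lemma vxJ b g a x : @vx b (g * J b a) x = vx g (act a x).
Proof. by apply/vx_eq; exists a; rewrite mulgK. Qed.

Lemma vx_inj b g : injective (@vx b g).
Proof.
move=> x y /vx_eq [a [ga ->]].
suff -> : a = 1 by rewrite act1.
apply: (@Jinj b); rewrite gmulf1g; apply: invg_inj; rewrite invg1.
by apply: (@mulgI _ g); rewrite mulg1.
Qed.

Lemma vx_starS b g s : S s -> vx (g * s) (star b) = vx g (star b).
Proof.
move=> Ss; have [a _ as_] := SJ b Ss; rewrite -as_ vxJ; congr vx.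
by apply/star_stab; rewrite as_.
Qed.

Lemma vx_star_inj b g g' : vx g (star b) = vx g' (star b) -> S (g^-1 * g').
Proof.
move=> /vx_eq [a [-> as_]]; rewrite mulKg; apply: subgroupV => //.
by apply/star_stab; rewrite -as_.
Qed.

Definition tact (h : G) (v : tvertex) : tvertex :=
  let p := repr v in vx (h * (tagged p).1) (tagged p).2.

Lemma tactE h b g x : tact h (@vx b g x) = vx (h * g) x.
Proof.
rewrite /tact /vx; case: piP => -[b' [g' x']] /= E.
have := vx_eq_type E => bb; subst b'; move/vx_eq: E => [a [-> ->]].
by rewrite -/(vx _ _) -/(vx _ _) -gmulfV mulgA vxJ actK.
Qed.

Lemma tact1 v : tact 1 v = v.
Proof. by elim/vx_ind: v => b g x; rewrite tactE mul1g. Qed.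

Lemma tactM g h v : tact (g * h) v = tact g (tact h v).
Proof. by elim/vx_ind: v => b k x; rewrite !tactE mulgA. Qed.

Definition tedge (u v : tvertex) : bool :=
  `[< (exists b g x y, [/\ e x y, u = @vx b g x & v = vx g y]) \/
      (exists b g, u = vx g (star b) /\ v = vx g (star (~~ b))) >].

Lemma tedge_piece b g x y : tedge (@vx b g x) (@vx b g y) = e x y.
Proof.
apply/asboolP/idP => [[[b' [g' [x' [y' [exy ux vy]]]]]|[b' [g' [ub vb]]]]|exy].
- have bb := vx_eq_type ux; subst b'; move/vx_eq: ux => [a [ga xa]].
  move: exy vy; rewrite ga xa -gmulfV vxJ => exy /vx_inj ->.
  by rewrite -(actK a x) acte.
- exfalso; have := vx_eq_type vb; have -> := vx_eq_type ub; by case: (b').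
- by left; exists b, g, x, y.
Qed.

Lemma tedge_bridge b g : tedge (vx g (star b)) (vx g (star (~~ b))).
Proof. by apply/asboolP; right; exists b, g. Qed.

Lemma tedge_ind (P : tvertex -> tvertex -> Prop) :
  (forall b g x y, e x y -> P (@vx b g x) (vx g y)) ->
  (forall b g, P (vx g (star b)) (vx g (star (~~ b)))) ->
  forall u v, tedge u v -> P u v.
Proof.
move=> P1 P2 u v /asboolP [[b [g [x [y [exy -> ->]]]]]|[b [g [-> ->]]]].
  exact: P1.
exact: P2.
Qed.

Lemma tedge_sym : symmetric tedge.
Proof.
suff sym u v : tedge u v -> tedge v u by move=> u v; apply/idP/idP; exact: sym.
elim/tedge_ind: u v / => [b g x y exy|b g].
  by rewrite tedge_piece; case: (conn b) => -> .
by have := tedge_bridge (~~ b) g; case: (b).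
Qed.

Lemma tedge_irr : irreflexive tedge.
Proof.
elim/vx_ind => b g x; rewrite tedge_piece; by case: (conn b) => _ -> .
Qed.

Lemma tact_edge g u v : tedge (tact g u) (tact g v) = tedge u v.
Proof.
have act_edge h x y : tedge x y -> tedge (tact h x) (tact h y).
  elim/tedge_ind: x y / => [b k x y exy|b k]; rewrite !tactE ?tedge_piece //.
  exact: tedge_bridge.
apply/idP/idP; last exact: act_edge.
by move=> /(act_edge g^-1); rewrite -!tactM mulVg !tact1.
Qed.

Lemma tact_graph_action : graph_action tedge tact.
Proof. by split; [exact: tact1|exact: tactM|exact: tact_edge]. Qed.

Lemma twalk_piece b g n x y :
  walk (@e b) setT n x y -> walk tedge setT n (vx g x) (vx g y).
Proof.
elim: n x => [|n IH] x /=; first by case=> _ ->.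
case=> _ [->|[z xz /IH zy]]; split=> //; first by left.
by right; exists (vx g z) => //; rewrite tedge_piece.
Qed.

(** Right multiplication of [g] by an element of [K b] stays in a copy of [V b], and bridges switch
    [b]; since both factors generate [G], every copy is reached. *)
Lemma tconn u v : exists2 p, path tedge u p & last u p = v.
Proof.
pose R x y := exists n, walk tedge setT n x y.
have Rt x y z : R x y -> R y z -> R x z.
  by move=> [n xy] [m yz]; exists (n + m)%N; exact: walk_cat yz.
have Rs x y : R x y -> R y x.
  by move=> [n xy]; exists n; apply: walk_sym => //; exact: tedge_sym.
suff [n /walkP [p [pp lp _ _]]] : R u v by exists p.
have Rpiece b g (x y : V b) : R (vx g x) (vx g y).
  have [_ _ _ c] := conn b; exists (dist (@e b) x y); apply: twalk_piece.
  exact: dist_walk.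
have Rstar g b b' : R (vx g (star b)) (vx g (star b')).
  have [->|] := eqVneq b' b; first exact: Rpiece.
  move=> bb; have -> : b' = ~~ b by case: b b' bb => -[].
  by exists 1%N; apply: walk1 => //; exact: tedge_bridge.
suff base b g (x : V b) : R (vx 1 (star true)) (vx g x).
  elim/vx_ind: u => b g x; elim/vx_ind: v => b' g' x'.
  by apply: (Rt _ (vx 1 (star true))); [apply: Rs|]; exact: base.
apply: (Rt _ (vx g (star b))); last exact: Rpiece.
apply: (Rt _ (vx g (star true))); last exact: Rstar.
apply: (ind (P := fun g => R (vx 1 (star true)) (vx g (star true)))).
  exact: Rpiece.
move=> d h a Rh; apply: (Rt _ _ _ Rh).
apply: (Rt _ (vx h (star d))); first exact: Rstar.
apply: (Rt _ (vx (h * J d a) (star d))); last exact: Rstar.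
by rewrite vxJ; exact: Rpiece.
Qed.

(** * Retraction of the tree of graphs onto a piece *)

Definition base_piece b (v : tvertex) := exists x : V b, v = vx 1 x.

Lemma in_pieceP b c g (x : V c) : in_piece J b g c <-> base_piece b (vx g x).
Proof.
split=> [[cb]|[y /[dup] /vx_eq_type cb]]; subst c.
  by case=> a _ <-; exists (act a x); rewrite -vxJ mul1g.
move=> /vx_eq [a [ga _]]; split=> //; exists a => //.
by rewrite -[LHS]mul1g ga mulgVK.
Qed.

(** The point at which walks from [v] enter the base copy of [V b]: [v] itself if it lies there,
    otherwise the translate of [star b] carrying the unique bridge of that copy beyond which [v]
    lies. *)
Definition gate b (v : tvertex) (y : V b) : Prop := v = vx 1 y \/
  ~ base_piece b v /\ exists c g (x : V c) a, [/\ v = vx g x, y = act a (star b)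
    & forall a', far side b (J b a') g c <-> S (J b (a^-1 * a'))].

Lemma gate_total b v : exists y, @gate b v y.
Proof.
have [[y vy]|nb] := pselect (base_piece b v); first by exists y; left.
elim/vx_ind: v nb => c g x nb.
have [|a aP] := @gate_exists _ _ J S side sS SJ ind side_J side_S b g c.
  by move=> /(in_pieceP b g x).
by exists (act a (star b)); right; split=> //; exists c, g, x, a.
Qed.

(** By [farM] the separating edge does not depend on the representative of [v], so [a] is determined
    modulo [S], and [S] fixes [star b]. *)
Lemma gate_uniq b v y y' : @gate b v y -> @gate b v y' -> y = y'.
Proof.
case=> [->|[nb [c [g [x [a [vx_ -> aP]]]]]]]; case=> [|[nb']].
- by move/vx_inj.
- by case: nb'; exists y.
- by move=> vy; case: nb; exists y'.
move=> [c' [g' [x' [a' [vx'_ -> aP']]]]].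
move: vx'_; rewrite vx_ => /[dup] /vx_eq_type cc; subst c'.
move=> /vx_eq [k [gg _]].
suff /star_stab : S (J b (a'^-1 * a)).
  by rewrite actM => /(congr1 (act a')); rewrite -actM mulgV act1.
by apply/aP'; rewrite gg -gmulfV farM //; apply/aP; rewrite mulVg gmulf1g;
  exact: subgroup1.
Qed.

Definition retract b (v : tvertex) : V b := xget (star b) (@gate b v).

Lemma retractP b v : @gate b v (retract b v).
Proof.
by rewrite /retract; case: xgetP => [y _ //|none];
  have [y /none] := gate_total b v.
Qed.

Lemma retract_eq b v y : @gate b v y -> retract b v = y.
Proof. by apply: gate_uniq; exact: retractP. Qed.

Lemma retract_base b x : retract b (vx 1 x) = x.
Proof. by apply: retract_eq; left. Qed.

Lemma base_pieceE b v : base_piece b v -> v = vx 1 (retract b v).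
Proof. by move=> [x ->]; rewrite retract_base. Qed.

Lemma base_piece_next b c g (x y : V c) :
  base_piece b (vx g x) <-> base_piece b (vx g y).
Proof. by rewrite -!in_pieceP. Qed.

(** If one end is in the base piece, the bridge itself is the gate of the other end; if neither is,
    [far_bridge] gives both ends the same gate. *)
Lemma retract_bridge b c g :
  retract b (vx g (star c)) = retract b (vx g (star (~~ c))).
Proof.
have bridge_in d : base_piece b (vx g (star d)) ->
    retract b (vx g (star d)) = retract b (vx g (star (~~ d))).
  move=> /in_pieceP [db [a _ ag]]; subst d.
  rewrite (retract_eq (y := act a (star b))); last first.
    by left; rewrite -ag -vxJ mul1g.
  apply/esym/retract_eq; right; split.
    by move=> [z /vx_eq_type]; case: (b).
  exists (~~ b), g, (star (~~ b)), a; split=> // a'.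
  rewrite -ag (far_neg side_J side_S); last by exists a'.
  have -> : J b (a^-1 * a') = ((J b a')^-1 * J b a)^-1.
    by rewrite invgM invgK gmulfM gmulfV.
  split=> [/asboolP|]; first exact: subgroupV.
  by move=> /(subgroupV sS); rewrite invgK => ?; apply/asboolP.
have [bc|nbc] := pselect (base_piece b (vx g (star c))); first exact: bridge_in.
have [bc'|nbc'] := pselect (base_piece b (vx g (star (~~ c)))).
  have := bridge_in (~~ c) bc'; clear.
  by case: c => /= ->.
apply: retract_eq; right; split=> //.
have [|a aP] := @gate_exists _ _ J S side sS SJ ind side_J side_S b g (~~ c).
  by move/(in_pieceP b g (star (~~ c))).
exists c, g, (star c), a; split=> //.
  apply: retract_eq; right; split=> //.
  by exists (~~ c), g, (star (~~ c)), a.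
move=> a'; rewrite -aP (far_bridge SJ side_S) //.
move=> rg; have [bc|cb] := eqVneq c b; subst.
  by apply: nbc; apply/in_pieceP.
by apply: nbc'; apply/in_pieceP; split=> //; apply/esym; move: cb; clear;
  case: c b => -[].
Qed.

(** The gate of a vertex outside the base piece depends only on the piece it lies in, so edges of
    other pieces are collapsed, as are bridges. *)
Lemma retract_edge b u v : tedge u v ->
  retract b u = retract b v \/
  [/\ u = vx 1 (retract b u), v = vx 1 (retract b v)
     & e (retract b u) (retract b v)].
Proof.
elim/tedge_ind: u v / => [c g x y exy|c g]; last by left; exact: retract_bridge.
have [bx|nbx] := pselect (base_piece b (vx g x)).
  have by_ := (base_piece_next b g x y).1 bx.
  right; split; [exact: base_pieceE..|].
  by rewrite -(tedge_piece 1) -!base_pieceE // tedge_piece.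
left; have [h|[_ [c' [g' [x' [a [xx ra aP]]]]]]] := retractP b (vx g x).
  by case: nbx; rewrite h; exists (retract b (vx g x)).
rewrite ra; apply/esym/retract_eq; right; split.
  by move/(base_piece_next b g y x).
have cc := vx_eq_type xx; subst c'; exists c, g, y, a; split=> // a'.
by move/vx_eq: xx => [k [gg _]]; rewrite -aP gg -gmulfV farM.
Qed.

Lemma walk_retract b (D : set tvertex) (D' : set (V b)) n u v :
  (forall y, D (vx 1 y) -> D' y) -> D' (retract b u) ->
  walk tedge D n u v -> walk (@e b) D' n (retract b u) (retract b v).
Proof.
move=> DD; elim: n u => [|n IH] u D'u /=; first by case=> _ <-.
case=> Du [<-|[w uw wv]]; first by split=> //; left.
have [ruw|[ub wb ee]] := retract_edge b uw.
  by rewrite ruw in D'u *; apply: (walk_mono _ (leqnSn n)) (IH _ D'u wv).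
have D'w : D' (retract b w) by apply: DD; rewrite -wb; exact: walk_src wv.
by split=> //; right; exists (retract b w) => //; exact: IH.
Qed.

(** The first edge that is not collapsed starts in the base piece, at the common retraction of all
    vertices up to that moment. *)
Lemma walk_through_retract b n u v :
  walk tedge setT n u v -> retract b u <> retract b v ->
  exists m k, [/\ (m + k <= n)%N, walk tedge setT m u (vx 1 (retract b u))
    & walk tedge setT k (vx 1 (retract b u)) v].
Proof.
elim: n u => [|n IH] u /=; first by case=> _ ->.
case=> _ [->//|[w uw wv]] ruv.
have [ruw|[ub wb ee]] := retract_edge b uw.
  have [|m [k [mk uu vv]]] := IH _ wv; first by rewrite -ruw.
  exists m.+1, k; rewrite -ruw in uu vv; split=> //; exact: walk_step uu.
exists 0%N, n.+1; split=> //.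
by rewrite -ub; split=> //; right; exists w.
Qed.

(** The base piece can be entered only over a bridge; the walk is cut before this bridge at the
    first entry, which makes [m] strictly smaller than [n]. *)
Lemma walk_through_bridge b n u v : ~ base_piece b u -> base_piece b v ->
  walk tedge setT n u v ->
  exists a m, [/\ (m < n)%N, retract b u = act a (star b)
    & walk tedge setT m u (vx (J b a) (star (~~ b)))].
Proof.
move=> nu bv; elim: n u nu => [|n IH] u nu /=; first by case=> _ uv; case: nu;
  rewrite uv.
case=> _ [uv|[w uw wv]]; first by case: nu; rewrite uv.
have [bw|nw] := pselect (base_piece b w); last first.
  have [a [m [mn rw ww]]] := IH w nw wv.
  exists a, m.+1; split=> //; last exact: walk_step ww.
  by have [->//|[ub _ _]] := retract_edge b uw; case: nu; exists (retract b u).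
elim/tedge_ind: u w / uw nu bw {IH wv} => [c g x y _ nx|c g nu].
  by move/(base_piece_next b g x y).
move=> /[dup] /in_pieceP [cb [a _ ag]] _; exists a, 0%N.
have cb' : c = ~~ b by rewrite -cb negbK.
subst c; rewrite ag; split=> //.
rewrite retract_bridge; apply: retract_eq; left.
rewrite -vxJ mul1g ag; by case: (b).
Qed.

(** After a translation the vertex lies in a base piece. Its neighbours there are controlled by
    retracting the walk to a detour in that piece, and at most one further neighbour is joined to it
    by a bridge. *)
Lemma tree_fine : (forall b, fine_graph (@e b)) -> fine_graph tedge.
Proof.
move=> efine; apply/fine_graphP => u v n; elim/vx_ind: u => b g x.
wlog -> : g v / g = 1 => [base|].
  have := base 1 (tact g^-1 v) erefl.
  move=> /(finite_image (tact g)); apply: sub_finite_set => y [xy yv].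
  exists (tact g^-1 y); last by rewrite -tactM mulgV tact1.
  split; first by rewrite -(tact_edge g) tactE mulg1 -tactM mulgV tact1.
  apply: (walk_mono _ (leqnn n)) (walk_act tact_graph_action g^-1 yv).
  move=> _ [z zn <-] zx; apply: zn.
  by rewrite -(tact1 z) -(mulgV g) tactM zx tactE mulg1.
pose bridge := [set y | exists h, vx 1 x = vx h (star b) /\ y = vx h (star (~~
  b))].
apply: (@sub_finite_set _ _ (vx 1 @` detour (@e b) x (retract b v) n `|`
  bridge)).
  move=> y [xy yv].
  have [[c [h [x' [y' [exy xx yy]]]]]|[c [h [xx yy]]]] := asboolP _ xy;
    last first.
    by right; have bc := vx_eq_type xx; subst c; exists h.
  left; have bc := vx_eq_type xx; subst c.
  have {}yy : y = vx 1 (retract b y).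
    apply: base_pieceE; rewrite yy; apply/(base_piece_next b h x' y').
    by rewrite -xx; exists x.
  exists (retract b y) => //; split; first by rewrite -(tedge_piece 1) -yy.
  apply: walk_retract yv => [z /= zx zx'|yx]; first by apply: zx; rewrite zx'.
  by move: xy; rewrite yy yx tedge_irr.
rewrite finite_setU; split.
  by apply: finite_image; have /fine_graphP := efine b; exact.
have [[y0 by0]|none] := pselect (exists y, bridge y); last first.
  by apply: (sub_finite_set _ (finite_set0 _)) => y ?; apply: none; exists y.
apply: (sub_finite_set _ (finite_set1 y0)) => y [h [xh ->]] /=.
case: by0 => [h' [xh' ->]]; rewrite xh in xh'.
(* A vertex determines the coset of [S] of a bridge at it, and [S] fixes the star at the other
   end. *)
by rewrite -(vx_starS _ _ (vx_star_inj xh')) mulVKg.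
Qed.

Let econn b (u v : V b) : exists2 p, path (@e b) u p & last u p = v.
Proof. by case: (conn b). Qed.

Lemma tdist_piece b (x y : V b) : dist tedge (vx 1 x) (vx 1 y) = dist (@e b) x
  y.
Proof.
apply/eqP; rewrite eqn_leq; apply/andP; split; apply: dist_le.
  by apply: twalk_piece; exact: dist_walk.
rewrite -{2}(retract_base x) -{2}(retract_base y).
by apply: (walk_retract (D := setT)) => //; apply: dist_walk; exact: tconn.
Qed.

(** A shortest walk between vertices with different retractions passes through the retraction of
    [u], and by symmetry through that of [v]. *)
Lemma tdist_retract b u v : retract b u <> retract b v ->
  dist tedge u v = (dist tedge u (vx 1 (retract b u)) +
    dist (@e b) (retract b u) (retract b v) + dist tedge (vx 1 (retract b v))
      v)%N.
Proof.
have half x y : retract b x <> retract b y -> dist tedge x y =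
    (dist tedge x (vx 1 (retract b x)) + dist tedge (vx 1 (retract b x)) y)%N.
  move=> xy; apply/eqP; rewrite eqn_leq dist_triangle /=; last exact: tconn.
  have [m [k [mk /dist_le xm /dist_le ky]]] :=
    walk_through_retract (dist_walk tconn x y) xy.
  by apply: leq_trans mk; exact: leq_add.
move=> uv; rewrite half // -addnA; congr addn.
have dsym x y := dist_sym tconn x y tedge_sym.
rewrite dsym half; last by rewrite retract_base => vu; apply: uv.
rewrite addnC tdist_piece (dsym v); congr addn.
by apply: dist_sym; [exact: econn|case: (conn b)].
Qed.

Lemma tdist_tact g u v : dist tedge (tact g u) (tact g v) = dist tedge u v.
Proof.
have le h x y : (dist tedge (tact h x) (tact h y) <= dist tedge x y)%N.
  by apply: dist_le;
    apply: (walk_mono _ _ (walk_act tact_graph_action h (dist_walk tconn x y))).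
apply/eqP; rewrite eqn_leq le /=.
by have := le g^-1 (tact g u) (tact g v); rewrite -!tactM mulVg !tact1.
Qed.

Lemma tdist_bridge b u : ~ base_piece b u -> exists a, retract b u = act a
  (star b) /\
  dist tedge u (vx 1 (retract b u)) =
    (dist tedge u (vx (J b a) (star (~~ b)))).+1.
Proof.
move=> nu; have bv : base_piece b (vx 1 (retract b u)) by exists (retract b u).
have [a [m [mn ra ua]]] := walk_through_bridge nu bv (dist_walk tconn _ _).
exists a; split=> //; apply/eqP; rewrite eqn_leq; apply/andP; split; last first.
  by apply: leq_ltn_trans mn; exact: dist_le.
rewrite -addn1; apply: leq_trans (dist_triangle tconn (vx (J b a) (star (~~
  b))) _ _) _.
rewrite leq_add2l; apply: dist_le; apply: walk1 => //.
by rewrite tedge_sym ra -vxJ mul1g; exact: tedge_bridge.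
Qed.

(** * Hyperbolicity of the tree of graphs *)

Section Hyperbolic.
Local Open Scope ring_scope.
Variable R : realType.
Hypothesis ehyp : forall b, gromov_hyperbolic [set: V b] (rdist R (@e b)).

Local Notation D := (rdist R tedge).
Local Notation orig b := (vx 1%g (star b)).

Let Dt w u v : D u v <= D u w + D w v.
Proof. exact: (rdist_triangle R tconn). Qed.

Let Ds u v : D u v = D v u.
Proof. exact: (rdist_sym R tedge_sym tconn). Qed.

(** Induction on the distance from [x] to the base point, for both base points at once. The points
    are projected to the base piece. If the projections do not all agree, hyperbolicity of the piece
    is used. If they agree and one point lies in the piece, the inequality is direct. Otherwise all
    three lie beyond the same bridge; moving the base point across it shifts all Gromov products
    equally, so [delta] does not grow. *)
Lemma tree_hyperbolic_orig : exists delta : R, forall b x y z,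
  Num.min (gromov_product D (orig b) x y) (gromov_product D (orig b) y z) -
    delta
    <= gromov_product D (orig b) x z.
Proof.
have [d1 h1] := ehyp true; have [d2 h2] := ehyp false.
pose delta := Num.max d1 d2; exists delta.
have hd b x y z : Num.min (gromov_product (rdist R (@e b)) (star b) x y)
    (gromov_product (rdist R (@e b)) (star b) y z) - delta
    <= gromov_product (rdist R (@e b)) (star b) x z.
  have dl : d1 <= delta /\ d2 <= delta by rewrite /delta !le_max !lexx orbT.
  by case: b x y z => x y z; [have := h1 (star true) x y z I I I I|
    have := h2 (star false) x y z I I I I]; lra.
have delta0 : 0 <= delta.
  have := hd true (star true) (star true) (star true).
  by rewrite /gromov_product rdistxx minxx; lra.
move=> b x; have [n] := ubnP (dist tedge x (orig b)).
elim: n b x => // n IH b x; rewrite ltnS => xn y z.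
pose r := retract b; pose h v := D v (vx 1%g (r v)).
pose rb := rdist R (@e b); pose q v := rb (r v) (star b).
have rbs u v : rb u v = rb v u.
  by apply: rdist_sym; [case: (conn b)|exact: econn].
have rbt w u v : rb u v <= rb u w + rb w v by exact: (rdist_triangle R (@econn
  b)).
have Dorig v : D v (orig b) = h v + q v.
  have [rv|rv] := pselect (r v = star b).
    by rewrite /h /q rv /rb rdistxx addr0.
  rewrite /rdist (@tdist_retract b); last by rewrite retract_base.
  by rewrite retract_base dist_refl addn0 natrD.
have Dsplit u v : r u <> r v -> D u v = h u + rb (r u) (r v) + h v.
  by move=> uv; rewrite /h (Ds v) /rdist (@tdist_retract b) // !natrD.
have Dsame u v : r u = r v -> D u v <= h u + h v.
  by move=> uv; rewrite /h (Ds v) uv; exact: Dt.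
(* For points with different projections the terms [h] cancel and the Gromov product is that of the
   projections; for a common projection it is at least [q]. *)
have [[xy yz]|nall] := pselect (r x = r y /\ r y = r z); last first.
  have := hd b (r x) (r y) (r z); rewrite /gromov_product !Dorig -/rb.
  rewrite -!/(q _).
  have [xy|xy] := pselect (r x = r y); have [yz|yz] := pselect (r y = r z);
    have [xz|xz] := pselect (r x = r z).
  - by case: nall.
  - by case: nall.
  - by case: nall; rewrite -xy.
  - by move=> _; apply/minB_le; right;
    rewrite (Dsplit _ _ yz) (Dsplit _ _ xz) /q xy; lra.
  - by case: nall; rewrite xz -yz.
  - by move=> _; apply/minB_le; left;
    rewrite (Dsplit _ _ xy) (Dsplit _ _ xz) /q -yz; lra.
  - move=> _; apply/minB_le; left; rewrite (Dsplit _ _ xy).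
    have := Dsame _ _ xz; have := rbt (r x) (r y) (star b).
    by rewrite (rbs (r y) (r x)) /q -xz; lra.
  - by rewrite (Dsplit _ _ xy) (Dsplit _ _ xz) (Dsplit _ _ yz) => /minB_le h0;
      apply/minB_le; lra.
have qxy : q y = q x by rewrite /q xy.
have qxz : q z = q x by rewrite /q xy yz.
have xz : r x = r z by rewrite xy.
have := Dsame _ _ xy; have := Dsame _ _ yz; have := Dsame _ _ xz.
have base v : base_piece b v -> h v = 0.
  by move=> /base_pieceE bv; rewrite /h /r -bv rdistxx.
have hD u v : r u = r v -> h v = 0 -> D u v = h u.
  move=> uv hv; apply/eqP; rewrite eq_le; apply/andP; split.
    by have := Dsame _ _ uv; rewrite hv addr0.
  by have := Dt v u (vx 1%g (r u)); rewrite {2}uv -/(h u) -/(h v) hv addr0.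
have [/base bx|nx] := pselect (base_piece b x).
  move=> Dxz Dyz Dxy; rewrite /gromov_product !Dorig.
  rewrite (Ds x y) (hD y x) // (Ds x z) (hD z x) // qxy qxz bx.
  by apply/minB_le; left; lra.
have [/base by_|ny] := pselect (base_piece b y).
  move=> Dxz Dyz Dxy; rewrite /gromov_product !Dorig (hD x y) // qxy qxz.
  by apply/minB_le; left; lra.
have [/base bz|nz] := pselect (base_piece b z).
  move=> Dxz Dyz Dxy; rewrite /gromov_product !Dorig (hD x z) // (hD y z) //.
  by rewrite qxy qxz; apply/minB_le; right; lra.
move=> _ _ _; have [a [ra _]] := tdist_bridge nx.
pose p := vx (J b a) (star (~~ b)).
have hp v : ~ base_piece b v -> r v = r x -> h v = D v p + 1.
  move=> /tdist_bridge [k [rk dk]] vx_.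
  rewrite /h /rdist dk -natr1 /p; congr ((dist _ _ _)%:R + 1).
  (* Different points may give different [a], but these agree modulo [S], so the far end [p] of the
     bridge is common to all. *)
  rewrite -(vx_starS (~~ b) (J b a) (s := J b (a^-1 * k)%g)).
    by rewrite -gmulfM mulVKg.
  by apply/star_stab; rewrite actM -rk -/(r v) vx_ /r ra -actM mulVg act1.
have hx := hp x nx erefl; have hy := hp y ny (esym xy);
  have hz := hp z nz (esym xz).
pose t v := tact (J b a)^-1%g v.
have pt : p = tact (J b a) (orig (~~ b)) by rewrite tactE mulg1.
have tD u v : D u v = D (t u) (t v) by rewrite /t /rdist tdist_tact.
have tp : t p = orig (~~ b) by rewrite /t pt -tactM mulVg tact1.
have q0 : 0 <= q x by exact: rdist_ge0.
(* The translation by [J b a] inverse takes [p] to the other base point, and the bridge just crossed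
   makes the distance smaller. *)
have lt : (dist tedge (t x) (orig (~~ b)) < n)%N.
  rewrite -tp /t tdist_tact; apply: leq_trans xn.
  by rewrite -(ltr_nat R) -!/(rdist R tedge _ _) Dorig hx; lra.
have /minB_le := IH (~~ b) (t x) lt (t y) (t z).
rewrite /gromov_product -tp -!tD !Dorig hx hy hz qxy qxz => IHx.
by apply/minB_le; lra.
Qed.

Lemma tree_hyperbolic : gromov_hyperbolic [set: tvertex] D.
Proof.
have [delta h] := tree_hyperbolic_orig.
apply: (gromov_hyperbolic_basepoint Ds (o := orig true) (delta := delta)).
exact: h.
Qed.


End Hyperbolic.

(** * Stabilizers and cocompactness for the tree of graphs *)

Lemma tstabE b g (x : V b) : vertex_stab tact (vx g x) =
  [set y ^ g^-1 | y in J b @` vertex_stab (@act b) x].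
Proof.
apply/seteqP; split=> [h|_ [_ [a ax <-] <-]]; rewrite /vertex_stab /= tactE.
  move=> /vx_eq [a [hg ax]]; exists (J b a); first by exists a.
  by rewrite conjgE invgK {1}hg mulgA mulgVK mulgK.
by rewrite conjgE invgK -mulgA mulgVK vxJ ax.
Qed.

Lemma tstabP b g (x : V b) h :
  vertex_stab tact (vx g x) h <-> exists2 a, act a x = x & h ^ g = J b a.
Proof.
rewrite tstabE; split=> [[_ [a ax <-] <-]|[a ax hg]].
  by exists a => //; rewrite conjgKV.
by exists (J b a); [exists a|rewrite -hg conjgK].
Qed.

Lemma tedge_stab_piece b g (x y : V b) : edge_stab tact (vx g x) (vx g y) =
  [set z ^ g^-1 | z in J b @` edge_stab (@act b) x y].
Proof.
apply/seteqP; split=> [h /= hxy|_ [_ [a axy <-] <-]].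
  have im u : [set x; y] u -> exists2 u', [set x;
    y] u' & vx (h * g) u = vx g u'.
    move=> xyu; have : (tact h @` [set vx g x; vx g y]) (vx (h * g) u).
      by rewrite -tactE; exists (vx g u) => //; case: xyu => ->; [left|right].
    by rewrite hxy => -[->|->]; [exists x; [left|]|exists y; [right|]].
  have im' u : [set x; y] u -> exists2 u', [set x;
    y] u' & vx (h * g) u' = vx g u.
    move=> xyu; have : [set vx g x; vx g y] (vx g u).
      by case: xyu => ->; [left|right].
    rewrite -hxy => -[_ [->|->] <-]; rewrite tactE.
      by exists x => //; left.
    by exists y => //; right.
  have [x' _ /esym /vx_eq [a [hg _]]] := im x (or_introl erefl).
  have {}hg : h * g = g * J b a^-1 by rewrite gmulfV.
  exists (J b a^-1); last by rewrite conjgE invgK mulgA -hg mulgK.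
  exists a^-1 => //; apply/seteqP;
    split=> [_ [u /im [u' xyu' E] <-]|u /im' [u' xyu' E]].
    by move: E; rewrite hg vxJ => /vx_inj ->.
  by exists u' => //; move: E; rewrite hg vxJ => /vx_inj ->.
have E u : tact ((J b a) ^ g^-1) (vx g u) = vx g (act a u).
  by rewrite tactE conjgE invgK -mulgA mulgVK vxJ.
rewrite /edge_stab /= image_setU !image_set1 !E.
have : vx g @` (act a @` [set x; y]) = vx g @` [set x; y] by rewrite axy.
by rewrite !image_setU !image_set1.
Qed.

(** The ends of a bridge belong to pieces of different types, so no element inverts it and its
    stabilizer fixes both ends. *)
Lemma tedge_stab_bridge b g :
  edge_stab tact (vx g (star b)) (vx g (star (~~ b))) `<=` [set s ^ g^-1 | s in
    S].
Proof.
move=> h /= hE.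
have : (tact h @` [set vx g (star b);
  vx g (star (~~ b))]) (vx (h * g) (star b)).
  by rewrite -tactE; exists (vx g (star b)) => //; left.
rewrite hE => -[hg|/vx_eq_type]; last by case: (b).
have Sg := vx_star_inj (esym hg); exists (g^-1 * (h * g)) => //.
by rewrite conjgE invgK !mulgA mulgV mul1g mulgK.
Qed.

(** By [two_pieces], a common stabilizer of vertices in different pieces lies in a conjugate of [S];
    in one piece the question reduces to that piece. This prepares the orbit condition on
    non-compact stabilizers. *)
Lemma tstab_same u v : vertex_stab tact u = vertex_stab tact v ->
  (exists k, vertex_stab tact u `<=` [set s ^ k | s in S]) \/
  exists b g (x y : V b), [/\ u = vx g x, v = vx g y &
    vertex_stab (@act b) x = vertex_stab (@act b) y].
Proof.
elim/vx_ind: u => b g x; elim/vx_ind: v => c g' y uv.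
pose H := [set h ^ g | h in vertex_stab tact (vx g x)].
have Hb : H `<=` range (J b).
  by move=> _ [h /tstabP [a _ ->] <-]; exists a.
have Hc h : H h -> range (J c) (h ^ (g^-1 * g')).
  by move=> [k + <-]; rewrite uv => /tstabP [a _ ka]; exists a;
    rewrite // conjgM conjgK.
have [[cb [a _ ga]]|[k Hk]] := two_pieces sS SJ ind side_J side_S Hb Hc.
  subst c; right; exists b, g, x, (act a y).
  have yE : vx g' y = vx g (act a y) by rewrite -vxJ ga mulVKg.
  split=> //; have sE z k : vertex_stab (@act b) z k <->
      vertex_stab tact (vx g z) (J b k ^ g^-1).
    rewrite tstabP conjgKV; split=> [kz|[l lz /Jinj ->//]]; by exists k.
  by apply/seteqP; split=> k /sE; [rewrite uv yE|rewrite -yE -uv] => /sE.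
left; exists (k * g^-1) => h hu.
have [s Ss sh] := Hk _ (imageP (fun h => h ^ g) hu).
by exists s => //; rewrite conjgM sh conjgK.
Qed.

Lemma tact_cocompact : (forall b, cocompact_action (@e b) (@act b)) ->
  cocompact_action tedge tact.
Proof.
move=> cc; have [Ft Ftc] := cc true; have [Ff Ffc] := cc false.
pose F b : set (V b) := if b as b0 return set (V b0) then Ft else Ff.
have FP b : [/\ finite_set (F b),
    forall v, exists g, exists2 x, F b x & v = act g x
  & forall u v, e u v -> exists g x y, [/\ F b x, F b y, u = act g x & v = act
    g y]].
  by case: b.
exists (\bigcup_(b in [set: bool]) (vx 1 @` (F b `|` [set star b]))); split.
- apply: bigcup_finite => // b _; apply: finite_image; rewrite finite_setU;
  split=> //.
  by case: (FP b).
- elim/vx_ind => b g x; have [_ /(_ x) [a [y Fy ->]] _] := FP b.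
  exists (g * J b a), (vx 1 y); last by rewrite tactE mulg1 vxJ.
  by exists b => //; exists y => //; left.
- apply: tedge_ind => [b g x y exy|b g].
    have [_ _ /(_ _ _ exy) [a [x' [y' [Fx Fy -> ->]]]]] := FP b.
    exists (g * J b a), (vx 1 x'), (vx 1 y'); rewrite !tactE !mulg1 !vxJ;
      split=> //.
      by exists b => //; exists x' => //; left.
    by exists b => //; exists y' => //; left.
  exists g, (vx 1 (star b)), (vx 1 (star (~~ b))); rewrite !tactE !mulg1;
    split=> //.
    by exists b => //; exists (star b) => //; right.
  by exists (~~ b) => //; exists (star (~~ b)) => //; right.
Qed.

End TreeOfGraphs.

(** * Proper pairs and the Cayley-Abels conditions for the tree *)

Section TopologicalStabilizers.
Local Open Scope group_scope.
Variable G : topologicalGroupType.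

Lemma open_conjg_image (g : G) (H : set G) : open H -> open [set x ^ g | x in
  H].
Proof.
move=> oH; rewrite (_ : _ @` _ = [set x | H (x ^ g^-1)]);
  first exact: open_conjg.
apply/seteqP; split=> [_ [x Hx <-]|x Hx] /=; first by rewrite conjgK.
by exists (x ^ g^-1) => //; rewrite conjgKV.
Qed.

Lemma compact_sub_conjg (g : G) (H S : set G) : subgroup H -> open H -> compact
  S ->
  H `<=` [set s ^ g | s in S] -> compact H.
Proof.
move=> sH oH cS; apply: subclosed_compact; first exact: open_subgroup_closed.
exact: compact_conjg.
Qed.

Variables (V : choiceType) (e : rel V) (act : G -> V -> V).
Hypotheses (actP : graph_action e act) (dact : discrete_action e act).

Lemma edge_stab_open u v : e u v -> open (edge_stab act u v).
Proof.
move=> uv; apply: (@open_supergroup _ (edge_pstab act u v)); last first.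
- exact: edge_pstab_stab.
- exact: (edge_stab_subgroup actP).
- by case: dact => _; exact.
have [u1 uM] := vertex_stab_subgroup actP u.
have [v1 vM] := vertex_stab_subgroup actP v.
by split=> [|x y [xu xv] [yu yv]]; split=> //; [exact: uM|exact: vM].
Qed.

End TopologicalStabilizers.

Section TopologicalTree.
Variables (G : topologicalGroupType) (K : bool -> topologicalGroupType).
Variables (J : forall b, {multiplicative K b -> G}) (S : set G).
Variables (side : G -> bool -> bool) (HH : forall b, set (set (K b))).
Local Open Scope group_scope.
Hypotheses (Jopen : forall b, open_embedding (J b))
  (sS : subgroup S) (cS : compact S) (SJ : forall b, S `<=` range (J b))
  (ind : forall P : set G, P 1 -> (forall b g a, P g -> P (g * J b a)) ->
     forall g, P g)
  (side_J : forall b g a, side (g * J b a) b = side g b)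
  (side_S : forall g, side g true (+) side g false = `[< S g >]).
Hypothesis HHproper : forall b, proper_pair (@HH b).

Definition tree_peripheral : set (set G) :=
  \bigcup_(b in [set: bool]) [set J b @` H | H in @HH b].

Let Jinj b : injective (J b). Proof. by case: (Jopen b). Qed.

Lemma HH_open b H : @HH b H -> open_subgroup H.
Proof. by case: (HHproper b) => _ [_ o] _; exact: o. Qed.

(** If [H] is conjugate by [g] to a subgroup of K_c, it fixes the vertices of K_b and g K_c. Being
    non-compact, it lies in no conjugate of [S], so b = c and [g] comes from [K b], where properness
    is known. *)
Lemma tree_proper : proper_pair tree_peripheral.
Proof.
split.
- by apply: (tdlc_embedding (Jopen true)); case: (HHproper true).
- split; last by move=> _ [b _ [H /HH_open oH <-]];
  exact: (image_open_subgroup (Jopen b)).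
  apply: bigcup_finite => // b _; apply: finite_image.
  by case: (HHproper b) => _ [].
move=> _ _ [b _ [H HbH <-]] [c _ [H' HcH' <-]] nH nH' [g HgH'].
have Hb : J b @` H `<=` range (J b) by move=> _ [a _ <-]; exists a.
have Hc h : (J b @` H) h -> range (J c) (h ^ g).
  move=> Hh; have : (J c @` H') (h ^ g) by rewrite HgH'; exists h.
  by case=> a _ <-; exists a.
have [sH oH] := image_open_subgroup (Jopen b) (HH_open HbH).
have [[cb [a _ ag]]|[k Hk]] := two_pieces sS SJ ind side_J side_S Hb Hc;
  last first.
  by case: nH; apply: compact_sub_conjg Hk.
subst c g; congr (J b @` _); case: (HHproper b) => _ _; apply=> //.
- by move=> /(open_embedding_compact (Jopen b)).
- by move=> /(open_embedding_compact (Jopen b)).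
exists a; have Ja x : J b (x ^ a) = J b x ^ J b a := gmulfJ (J b) x a.
apply/seteqP; split=> [x H'x|_ [x Hx <-]].
  have : (J b @` H') (J b x) by exists x.
  rewrite HgH' => -[_ [y Hy <-]]; rewrite -Ja => /Jinj <-.
  by exists y.
have : [set x ^ J b a | x in J b @` H] (J b (x ^ a)).
  by exists (J b x); [exists x|rewrite Ja].
by rewrite -HgH' => -[y H'y /Jinj <-].
Qed.

Variables (V : bool -> choiceType) (e : forall b, rel (V b)).
Variables (act : forall b, K b -> V b -> V b) (star : forall b, V b).
Hypotheses (ca : forall b, cayley_abels (@HH b) (@e b) (@act b))
  (star_stab : forall b a, act a (star b) = star b <-> S (J b a)).

Let conn b : connected_simplicial_graph (@e b).
Proof. by case: (ca b) => -[]. Qed.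

Lemma tree_actP b : graph_action (@e b) (@act b).
Proof. by case: (ca b) => -[]. Qed.

Local Notation tE := (@tedge _ _ J V e act star tree_actP).
Local Notation tA := (@tact _ _ J V e act tree_actP).

Lemma tree_discrete : discrete_action tE tA.
Proof.
have ov v : open (vertex_stab tA v).
  elim/vx_ind: v => b g x; rewrite tstabE //; apply: open_conjg_image.
  case: (Jopen b) => _ _; apply.
  by case: (ca b) => -[_ _ _ [+ _]] _; exact.
by split=> // u v _; exact: openI.
Qed.

Lemma tree_cayley_abels : cayley_abels tree_peripheral tE tA.
Proof.
have actT : graph_action tE tA by exact: tact_graph_action.
have irr : irreflexive tE by exact: tedge_irr.
split; first split.
- split; [exact: tedge_sym| |by exists; exact: (vx J tree_actP 1 (star true))|].
    exact: irr.
  exact: tconn.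
- exact: actT.
- by apply: tact_cocompact => b; case: (ca b) => -[].
- exact: tree_discrete.
split.
- move=> u v uv; have oE := edge_stab_open actT tree_discrete uv.
  have sE := edge_stab_subgroup actT u v.
  move: uv oE sE; elim/tedge_ind: u v / => [b g x y exy|b g] oE sE.
    rewrite tedge_stab_piece //; apply: compact_conjg;
      apply: open_embedding_compact => //.
    by case: (ca b) => _ [+ _ _ _]; exact.
  by apply: (@compact_sub_conjg _ g^-1 _ S sE oE cS); exact: tedge_stab_bridge.
- elim/vx_ind => b g x; rewrite tstabE //.
  case: (ca b) => _ [_ /(_ x) + _ _] => -[cx|[H HbH [k xk]]].
    by left; apply: compact_conjg; exact: open_embedding_compact.
  right; exists (J b @` H); first by exists b => //; exists H.
  exists (J b k * g^-1); rewrite xk.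
  apply/seteqP; split=> [_ [_ [_ [h Hh <-] <-] <-]|_ [_ [h Hh <-] <-]].
    exists (J b h); first by exists h.
    by rewrite conjgM -gmulfJ.
  exists (J b (h ^ k)); first by exists (h ^ k) => //; exists h.
  by rewrite conjgM -gmulfJ.
- move=> _ [b _ [H HbH <-]]; case: (ca b) => _ [_ _ /(_ _ HbH) [x xH] _].
  exists (vx J tree_actP 1 x); rewrite tstabE // xH.
  by apply/seteqP; split=> [_ [h Hh <-]|h Hh]; [rewrite invg1 conjg1|exists h;
    rewrite // invg1 conjg1].
- move=> H u v HH' nH uH vH.
  have [sH oH] : open_subgroup H by case: HH' => b _ [H' /HH_open oH' <-];
    exact: (image_open_subgroup (Jopen b)).
  have [|[k]|[b [g [x [y [ug -> xy]]]]]] := tstab_same Jinj sS SJ ind side_J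
    side_S (u := u) (v := v).
  by rewrite uH vH.
  by rewrite uH => Hk; case: nH; apply: compact_sub_conjg Hk.
    rewrite ug in uH *;
      case: (ca b) => _ [_ /(_ x) + _ orb] => -[cx|[H1 HbH1 [k xk]]].
      case: nH; rewrite -uH tstabE //; apply: compact_conjg.
      exact: open_embedding_compact.
    (* The stabilizer of [x] is only conjugate to the peripheral subgroup [H1]. Translating by [k]
       makes it equal to [H1], so that the orbit condition in the piece applies. *)
    have stab1 z : vertex_stab (@act b) z = vertex_stab (@act b) x ->
        vertex_stab (@act b) (act k z) = H1.
      move=> zx; rewrite (vertex_stab_act (tree_actP b)) zx xk.
      apply/seteqP; split=> [_ [_ [h Hh <-] <-]|h Hh]; first by rewrite conjgK.
      by exists (h ^ k); [exists h|rewrite conjgK].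
    have nH1 : ~ compact H1.
      move=> cH1; case: nH; rewrite -uH tstabE // xk; apply: compact_conjg.
      by apply: open_embedding_compact => //; exact: compact_conjg.
    have [a ay] := orb _ _ _ HbH1 nH1 (stab1 x erefl) (stab1 y (esym xy)).
    exists (g * J b (k^-1 * (a * k)) * g^-1); rewrite tactE // mulgVK vxJ;
      congr vx.
    case: (tree_actP b) => a1 aM _.
    by rewrite !aM -ay -aM mulVg a1.
Qed.


End TopologicalTree.

(** * Coning off the translates of a finite set *)

Lemma finite_set_uniform (T : eqType) (F : set T) (P : nat -> T -> Prop) :
  (forall m n x, (m <= n)%N -> P m x -> P n x) -> finite_set F ->
  (forall x, F x -> exists n, P n x) -> exists n, forall x, F x -> P n x.
Proof.
move=> mono /finite_seqP [s ->] {F}; elim: s => [|x s IH] Ps;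
  first by exists 0%N.
have [n nP] := Ps x (mem_head _ _).
have [|m mP] := IH; first by move=> y ys; apply: Ps; rewrite /= inE ys orbT.
exists (maxn m n) => y /=; rewrite inE => /orP [/eqP ->|/mP].
  by apply: mono nP; exact: leq_maxr.
by apply: mono; exact: leq_maxl.
Qed.

Section Cone.
Variables (A : topologicalGroupType) (HH : set (set A)).
Variables (V : choiceType) (e : rel V) (act : A -> V -> V).
Variables (C : set A) (F : set V) (x0 : V) (l : nat).
Local Open Scope group_scope.
Hypotheses (ca : cayley_abels HH e act) (sC : subgroup C) (oC : open C)
  (cC : compact C).
Hypotheses (finF : finite_set F) (Fx0 : F x0)
  (FC : forall c v, C c -> F v -> F (act c v))
  (Fwalk : forall u v, F u -> F v -> walk e F l u v).

Let econn : connected_simplicial_graph e. Proof. by case: ca => -[]. Qed.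

Let econn2 u v : exists2 p, path e u p & last u p = v.
Proof. by case: econn. Qed.

Let actP : graph_action e act. Proof. by case: ca => -[]. Qed.

Let dact : discrete_action e act. Proof. by case: ca => -[]. Qed.

Let act1 v : act 1 v = v. Proof. by case: actP. Qed.

Let actM a b v : act (a * b) v = act a (act b v). Proof. by case: actP. Qed.

Let act_inj a : injective (act a).
Proof. by have := can_inj (@graph_actK _ _ e act actP a). Qed.

Definition lcos (a : A) : set A := [set x | C (a^-1 * x)].

Lemma lcos_eq a b : lcos a = lcos b <-> C (a^-1 * b).
Proof.
split=> [|Cab]; first by move/seteqP => [_ /(_ b)]; apply;
  rewrite /lcos /= mulVg; exact: subgroup1.
have E x : C (a^-1 * x) <-> C (b^-1 * x).
  by rewrite -(subgroupMl sC (b^-1 * x) Cab) -mulgA mulVKg.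
by apply/seteqP; split=> x; rewrite /lcos /= E.
Qed.

Definition ltrans (g : A) (c : set A) : set A := [set x | c (g^-1 * x)].

Lemma ltrans_lcos g a : ltrans g (lcos a) = lcos (g * a).
Proof. by apply/funext => x; rewrite /ltrans /lcos /= invgM -mulgA. Qed.

Lemma ltrans1 c : ltrans 1 c = c.
Proof. by apply/funext => x; rewrite /ltrans /= invg1 mul1g. Qed.

Lemma ltransM g h c : ltrans (g * h) c = ltrans g (ltrans h c).
Proof. by apply/funext => x; rewrite /ltrans /= invgM -mulgA. Qed.

(* The translate a F attached to the coset c = a C. *)
Definition fill (c : set A) : set V :=
  [set s | exists a f, [/\ c = lcos a, F f & s = act a f]].

(** As [F] is invariant under [C], the translate of [F] depends only on the coset. *)
Lemma fill_lcos a : fill (lcos a) = act a @` F.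
Proof.
apply/seteqP; split=> [_ [b [f [/lcos_eq Cab Ff ->]]]|_ [f Ff <-]]; last first.
  by exists a, f.
by exists (act (a^-1 * b) f); [exact: FC|rewrite -actM mulVKg].
Qed.

Lemma fill_ltrans g c s : fill c s -> fill (ltrans g c) (act g s).
Proof.
by move=> [a [f [-> Ff ->]]]; exists (g * a), f; rewrite ltrans_lcos actM.
Qed.

Lemma fill_finite c : finite_set (fill c).
Proof.
have [[a ->]|nc] := pselect (exists a, c = lcos a).
  by rewrite fill_lcos; exact: finite_image.
by apply: (sub_finite_set _ (finite_set0 _)) => s [a [f [ca_ _ _]]]; apply: nc;
  exists a.
Qed.

Lemma fill_walk c u v : fill c u -> fill c v -> walk e (fill c) l u v.
Proof.
move=> [a [f [-> Ff ->]]]; rewrite fill_lcos => -[f' Ff' <-].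
by apply: (walk_act actP); exact: Fwalk.
Qed.

(** The elements carrying a given edge of [F] to the given edge form a translate of a pointwise edge
    stabilizer, which is compact. The map to cosets of the open subgroup [C] is locally constant, so
    it takes finitely many values there. *)
Lemma fill_edge u v : e u v -> finite_set [set c | fill c u /\ fill c v].
Proof.
move=> uv.
pose trans f f' := [set a | act a f = u /\ act a f' = v].
apply: (@sub_finite_set _ _ (\bigcup_(f in F) \bigcup_(f' in F) (lcos @` trans
  f f'))).
  move=> _ [[a [f [-> Ff uf]]]]; rewrite fill_lcos => -[f' Ff' f'v].
  by exists f => //; exists f' => //; exists a.
apply: bigcup_finite => // f Ff; apply: bigcup_finite => // f' Ff'.
apply: compact_locally_constant.
  have [[a0 [fu fv]]|none] := pselect (exists a, trans f f' a); last first.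
    rewrite (_ : trans f f' = set0); first exact: compact0.
    by apply/seteqP; split=> // a ta; apply: none; exists a.
  have ff' : e f f' by case: actP => _ _ ae; rewrite -(ae a0) fu fv.
  rewrite (_ : trans f f' = (fun x => a0 * x) @` edge_pstab act f f').
    apply: continuous_compact.
      by apply: continuous_subspaceT; exact: mulgl_continuous.
    apply: (@subclosed_compact _ _ (edge_stab act f f')).
    - apply: open_subgroup_closed; last by case: dact => _; exact.
      have [f1 fM] := vertex_stab_subgroup actP f.
      have [f'1 f'M] := vertex_stab_subgroup actP f'.
      by split=> [|x y [xu xv] [yu yv]]; split=> //; [exact: fM|exact: f'M].
    - by case: ca => _ [+ _ _ _]; exact.
    - exact: edge_pstab_stab.
  apply/seteqP; split=> [a [af af']|_ [k [kf kf'] <-]]; last first.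
    by split; rewrite actM ?kf ?kf'.
  exists (a0^-1 * a); last by rewrite mulVKg.
  by split; rewrite /vertex_stab /= actM ?af ?af' -?fu -?fv -actM mulVg act1.
move=> a _; apply: filterS (nbhs_lcoset sC oC a) => b /= Cab.
by apply/esym/lcos_eq.
Qed.

Definition cone_ok (w : set A * option (V * nat)) : Prop :=
  (exists a, w.1 = lcos a) /\
  (if w.2 is Some (s, i) then fill w.1 s /\ (i <= l)%N else True).

(* For each coset c, a cone vertex (c, None) and, for each s in fill c, a leg
   of vertices (c, Some (s, i)) from s (at i = 0) to the cone vertex. *)
Definition cone_vertex : choiceType := {classic {w | cone_ok w}}.

Definition cone_coset (w : cone_vertex) : set A := (sval w).1.

Definition cone_adj (o o' : option (V * nat)) : bool :=
  match o, o' with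
  | Some (s, i), Some (s', j) => (s == s') && ((j == i.+1) || (i == j.+1))
  | Some (_, i), None | None, Some (_, i) => i == l
  | None, None => false
  end.

Definition cone_edge (p q : (V + cone_vertex)%type) : bool :=
  match p, q with
  | inl u, inl v => e u v
  | inl u, inr w | inr w, inl u => (sval w).2 == Some (u, 0%N)
  | inr w, inr w' =>
      `[< cone_coset w = cone_coset w' >] && cone_adj (sval w).2 (sval w').2
  end.

Lemma cone_sval_inj : injective (sval : cone_vertex -> _).
Proof. by move=> [w h] [w' h'] /= ww; subst w'; congr exist;
  exact: Prop_irrelevance. Qed.

Lemma cone_cosetP (w : cone_vertex) : exists a, cone_coset w = lcos a.
Proof. by case: w => w []. Qed.

Lemma cone_leg (w : cone_vertex) s i : (sval w).2 = Some (s, i) ->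
  fill (cone_coset w) s /\ (i <= l)%N.
Proof. by have [_ h] := proj2_sig w => wE; rewrite wE in h. Qed.

Lemma cone_edge_sym : symmetric cone_edge.
Proof.
have es : symmetric e by case: econn.
have as_ : symmetric cone_adj.
  move=> [[s i]|] [[s' j]|] //=; by rewrite eq_sym orbC.
move=> [u|w] [v|w'] //=; rewrite as_; congr (_ && _).
by apply/asboolP/asboolP.
Qed.

Lemma cone_coset_finite c : finite_set [set w : cone_vertex | cone_coset w = c].
Proof.
pose B := [set c] `*` ([set None] `|` (Some @` (fill c `*` `I_l.+1))).
apply: (@sub_finite_set _ _ ((sval : cone_vertex -> _) @^-1` B)).
  move=> w /= wc; split=> //=.
  case E : (sval w).2 => [[s i]|]; last by left.
  have [fs il] := cone_leg E; right; exists (s, i) => //.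
  by split=> //=; rewrite -wc.
apply: finite_preimage; first by move=> w w' _ _; exact: cone_sval_inj.
apply: finite_setX => //; rewrite finite_setU; split=> //.
by apply: finite_image; apply: finite_setX => //; exact: fill_finite.
Qed.

Lemma cone_fine : fine_graph e -> fine_graph cone_edge.
Proof.
have es : symmetric e by case: econn.
apply: (@attach_fine V cone_vertex (set A) e cone_edge cone_coset fill l) => //.
- exact: cone_edge_sym.
- by move=> u w /= /eqP E; case: (cone_leg E).
- by move=> w w' /= /andP [/asboolP].
- exact: cone_coset_finite.
- exact: fill_finite.
- exact: fill_walk.
- exact: fill_edge.
Qed.

Lemma cone_make c o : cone_ok (c, o) -> exists w : cone_vertex, sval w = (c, o).
Proof. by move=> h; exists (exist _ (c, o) h). Qed.

Lemma fill_nonempty (w : cone_vertex) : exists s, fill (cone_coset w) s.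
Proof. by have [a ->] := cone_cosetP w; exists (act a x0); exists a, x0. Qed.

(** The choice depends only on the coset, so all vertices of one cone share it; [fill] is non-empty,
    so the default is never taken. *)
Definition cone_base (w : cone_vertex) : V := xget x0 (fill (cone_coset w)).

Lemma cone_baseP w : fill (cone_coset w) (cone_base w).
Proof.
rewrite /cone_base; case: xgetP => // none; have [s /none] := fill_nonempty w.
by [].
Qed.

Definition foot (p : V + cone_vertex) : V :=
  match p with
  | inl v => v
  | inr w => if (sval w).2 is Some (s, _) then s else cone_base w
  end.

(** A leg has l + 2 edges: one from its foot to index 0, [l] up to index [l], and one to the cone
    vertex. *)
Lemma foot_walk p : walk cone_edge setT l.+2 p (inl (foot p)).
Proof.
case: p => [v|w]; first exact: walk_refl.
have leg i : forall w s, (sval w).2 = Some (s, i) ->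
    walk cone_edge setT i.+1 (inr w) (inl s).
  elim: i => [|i IH] {}w s ws; first by apply: walk1 => //=; rewrite ws.
  have [fs il] := cone_leg ws.
  have [w' ww'] : exists w' : cone_vertex, sval w' = (cone_coset w, Some (s,
    i)).
    by apply: cone_make; split; [exact: cone_cosetP|split=> //; exact: ltnW].
  apply: (walk_step _ _ (IH w' s _)) => //=; last by rewrite ww'.
  by rewrite ws ww' /= !eqxx orbT !andbT; apply/asboolP;
    rewrite /cone_coset ww'.
rewrite /foot; case E : (sval w).2 => [[s i]|].
  by apply: (walk_mono _ _ (leg _ _ _ E)) => //; have [_] := cone_leg E; lia.
have [w' ww'] : exists w' : cone_vertex,
    sval w' = (cone_coset w, Some (cone_base w, l)).
  by apply: cone_make; split; [exact: cone_cosetP|split=> //;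
    exact: cone_baseP].
apply: (walk_step _ _ (leg l w' (cone_base w) _)) => //=; last by rewrite ww'.
by rewrite E ww' /= eqxx andbT; apply/asboolP; rewrite /cone_coset ww'.
Qed.

Lemma cone_walk_inl n u v : walk e setT n u v -> walk cone_edge setT n (inl u)
  (inl v).
Proof.
elim: n u => [|n IH] u /=; first by case=> _ ->.
by case=> _ [->|[w uw /IH wv]]; split=> //; [left|right; exists (inl w)].
Qed.

Lemma cone_conn p q : exists2 s, path cone_edge p s & last p s = q.
Proof.
have /walkP [s [ss ls _ _]] := walk_cat (walk_cat (foot_walk p)
  (cone_walk_inl (dist_walk econn2 (foot p) (foot q))))
  (walk_sym cone_edge_sym (foot_walk q)).
by exists s.
Qed.

(* A 1-Lipschitz extension to the cones of the distance to x in X: it exists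
   because the legs are at least as long as the diameter of F. *)
Definition cone_potential (x : V) (p : V + cone_vertex) : nat :=
  match p with
  | inl v => dist e x v
  | inr w =>
      let t := dist e x (cone_base w) in
      if (sval w).2 is Some (s, i) then minn (dist e x s + i) (t + (l - i))
        else t
  end.

Lemma cone_potential_lipschitz x p q : cone_edge p q ->
  (cone_potential x q <= cone_potential x p + 1)%N.
Proof.
have es : symmetric e by case: econn.
have near w s i : (sval w).2 = Some (s, i) ->
    [/\ (dist e x s <= dist e x (cone_base w) + l)%N,
        (dist e x (cone_base w) <= dist e x s + l)%N & (i <= l)%N].
  move=> /cone_leg [fs il]; have bw := cone_baseP w.
  have d1 : (dist e s (cone_base w) <= l)%N.
    apply: dist_le; apply: (walk_mono _ (leqnn l)) (fill_walk fs bw) => //.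
  have := dist_triangle econn2 s x (cone_base w).
  have := dist_triangle econn2 (cone_base w) x s.
  by rewrite (dist_sym econn2 (cone_base w)) // => *; split=> //; lia.
have base w w' : cone_coset w = cone_coset w' -> cone_base w = cone_base w'.
  by rewrite /cone_base => ->.
case: p q => [u|w] [v|w'] /=.
- move=> uv; apply: leq_trans (dist_triangle econn2 u _ _) _; rewrite leq_add2l.
  by apply: dist_le; exact: walk1.
- by move=> /eqP /[dup] /near [? ? ?] ->; lia.
- by move=> /eqP /[dup] /near [? ? ?] ->; lia.
move=> /andP [/asboolP /base ww'].
case E : (sval w).2 => [[s i]|]; case E' : (sval w').2 => [[s' j]|] //=.
- move=> /andP [/eqP ss' ij]; subst s'; rewrite ww'.
  by have [? ? ?] := near _ _ _ E; have [? ? ?] := near _ _ _ E'; lia.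
- by move=> /eqP il; have [? ? ?] := near _ _ _ E; rewrite -ww'; lia.
- by move=> /eqP il; have [? ? ?] := near _ _ _ E'; rewrite ww'; lia.
Qed.

(** The Lipschitz potential vanishes at [u] and equals the old distance at [v], so the cones create
    no shortcut. *)
Lemma cone_dist u v : dist cone_edge (inl u) (inl v) = dist e u v.
Proof.
apply/eqP; rewrite eqn_leq; apply/andP; split.
  by apply: dist_le; apply: cone_walk_inl; exact: dist_walk.
have := walk_lipschitz (cone_potential_lipschitz u)
  (dist_walk cone_conn (inl u) (inl v)).
by rewrite /= dist_refl.
Qed.

(** The old graph is isometrically embedded and every vertex is within l + 2 of its foot, so [foot]
    changes distances by at most twice this amount. *)
Lemma cone_hyperbolic (R : realType) : gromov_hyperbolic [set: V] (rdist R e) ->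
  gromov_hyperbolic [set: (V + cone_vertex)%type] (rdist R cone_edge).
Proof.
apply: (@gromov_hyperbolic_transfer R _ _ _ _ _ _ foot (l.+2 + l.+2)%:R) => //
  p q _ _.
have rt w u v := rdist_triangle R cone_conn w u v.
have rs u v := rdist_sym R cone_edge_sym cone_conn u v.
have close w : (rdist R cone_edge w (inl (foot w)) <= l.+2%:R)%R.
  by rewrite ler_nat; apply: dist_le; exact: foot_walk.
rewrite {2}/rdist -cone_dist -/(rdist _ _ _ _) natrD ler_norml.
have := close p; have := close q.
have := rt (inl (foot p)) p q; have := rt (inl (foot q)) (inl (foot p)) q.
have := rt p (inl (foot p)) (inl (foot q)); have := rt q p (inl (foot q)).
rewrite (rs (inl (foot q)) q) (rs (inl (foot p)) p) => *.
by apply/andP; split; lra.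
Qed.

(** * The action on the coned graph *)

Definition leg_act (g : A) (o : option (V * nat)) : option (V * nat) :=
  if o is Some (s, i) then Some (act g s, i) else None.

Lemma cone_ok_act g (w : cone_vertex) :
  cone_ok (ltrans g (cone_coset w), leg_act g (sval w).2).
Proof.
split; first by have [a ->] := cone_cosetP w; exists (g * a);
  rewrite /= ltrans_lcos.
case E : (sval w).2 => [[s i]|] //=; have [fs il] := cone_leg E.
by split=> //; exact: fill_ltrans.
Qed.

Lemma cone_coset_act g w :
  cone_coset (exist _ _ (cone_ok_act g w)) = ltrans g (cone_coset w).
Proof. by []. Qed.

Definition cone_act (g : A) (p : (V + cone_vertex)%type) : (V +
  cone_vertex)%type :=
  match p with
  | inl v => inl (act g v)
  | inr w => inr (exist _ _ (cone_ok_act g w))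
  end.

Lemma leg_act_eq g o s i : (leg_act g o == Some (act g s, i)) = (o == Some (s,
  i)).
Proof.
apply/eqP/eqP => [|->//]; case: o => [[s' i']|] //= [ss ->].
by rewrite (act_inj ss).
Qed.

Lemma ltrans_inj g : injective (ltrans g).
Proof. by move=> c d /(congr1 (ltrans g^-1));
  rewrite -!ltransM mulVg !ltrans1. Qed.

Lemma cone_graph_action : graph_action cone_edge cone_act.
Proof.
have ae g u v : e (act g u) (act g v) = e u v by case: actP.
split.
- move=> [v|w]; rewrite /= ?act1 //; congr inr; apply: cone_sval_inj => /=.
  case: w => -[c o] h; rewrite /cone_coset /= ltrans1; congr pair.
  by case: o {h} => [[s i]|] //=; rewrite act1.
- move=> g h [v|w]; rewrite /= ?actM //; congr inr; apply: cone_sval_inj => /=.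
  rewrite {2}/cone_coset /= ltransM; congr pair.
  by case: (sval w).2 => [[s i]|] //=; rewrite actM.
- move=> g [u|w] [v|w'] /=; rewrite ?ae ?leg_act_eq //.
  congr (_ && _).
    by rewrite !cone_coset_act; apply/asboolP/asboolP => [/ltrans_inj|->].
  case: (sval w).2 => [[s i]|]; case: (sval w').2 => [[s' i']|] //=.
  congr (_ && _); apply/eqP/eqP => [ss|->//].
  exact: act_inj ss.
Qed.

Lemma cone_stab_coset g w w' a : cone_act g (inr w) = inr w' ->
  cone_coset w = lcos a -> cone_coset w' = lcos a -> C (g ^ a).
Proof.
move=> [] /(congr1 (fun w : cone_vertex => cone_coset w)) /= gw wa w'a.
move: gw; rewrite w'a {1}/cone_coset /= wa ltrans_lcos => /esym/lcos_eq.
by rewrite conjgE.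
Qed.

Lemma cone_stab_sub w : exists a, vertex_stab cone_act (inr w) `<=` [set x ^ a
  | x in C].
Proof.
have [a wa] := cone_cosetP w; exists a^-1 => g gw.
by exists (g ^ a); [exact: (cone_stab_coset gw wa wa)|rewrite conjgK].
Qed.

Lemma cone_stab_inl v : vertex_stab cone_act (inl v) = vertex_stab act v.
Proof. by apply/seteqP; split=> g; [case|rewrite /vertex_stab /= => ->]. Qed.

Lemma cone_stab_inr w a : cone_coset w = lcos a -> vertex_stab cone_act (inr w)
  =
  [set g | C (g ^ a)] `&` (if (sval w).2 is Some (s, _) then vertex_stab act s
    else setT).
Proof.
move=> wa; apply/seteqP; split=> g.
  move=> gw; split; first exact: (cone_stab_coset gw wa wa).
  move: gw => [] /(congr1 (fun w : cone_vertex => (sval w).2)) /=.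
  by case: (sval w).2 => [[s i]|] //= [].
move=> [Cga gs]; rewrite /vertex_stab /=; congr inr; apply: cone_sval_inj => /=.
rewrite [in RHS](surjective_pairing (sval w)); congr pair.
  rewrite wa ltrans_lcos -[RHS]/(cone_coset w) wa; apply/esym/lcos_eq.
  by rewrite -conjgE.
by case: (sval w).2 gs => [[s i]|] //= ->.
Qed.

Lemma cone_discrete : discrete_action cone_edge cone_act.
Proof.
have ov p : open (vertex_stab cone_act p).
  case: p => [v|w]; first by rewrite cone_stab_inl; case: dact.
  have [a wa] := cone_cosetP w; rewrite (cone_stab_inr wa); apply: openI.
    exact: open_conjg.
  by case: (sval w).2 => [[s i]|]; [case: dact|exact: openT].
by split=> // p q _; exact: openI.
Qed.

Lemma cone_stab_compact w : compact (vertex_stab cone_act (inr w)).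
Proof.
have [a wa] := cone_stab_sub w.
apply: compact_sub_conjg cC wa; last by case: cone_discrete.
exact: (vertex_stab_subgroup cone_graph_action).
Qed.

(** An element preserving the edge sends [w] to itself or to another vertex of the same cone, hence
    preserves its coset and lies in a conjugate of [C]. *)
Lemma cone_edge_stab_inr (w : cone_vertex) q :
  (forall w', q = inr w' -> cone_coset w' = cone_coset w) -> cone_edge (inr w)
    q ->
  compact (edge_stab cone_act (inr w) q).
Proof.
move=> qw wq; have [a wa] := cone_cosetP w.
apply: (@compact_sub_conjg _ a^-1 _ C) => //.
- exact: (edge_stab_subgroup cone_graph_action).
- exact: (edge_stab_open cone_graph_action cone_discrete wq).
move=> g gE; exists (g ^ a); last by rewrite conjgK.
have : (cone_act g @` [set inr w; q]) (cone_act g (inr w)).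
  by exists (inr w) => //; left.
rewrite gE => -[gw|gq]; first exact: (cone_stab_coset gw wa wa).
case: q gq qw {wq gE} => [//|w'] gq qw.
by apply: (cone_stab_coset gq wa); rewrite qw.
Qed.

Lemma cone_cayley_abels : cayley_abels HH cone_edge cone_act.
Proof.
have [_ [eC vS HS orb]] := ca.
split; first split.
- split; [exact: cone_edge_sym| |by exists; exact: inl x0|exact: cone_conn].
  move=> [v|w] /=; first by case: econn => _ ->.
  by apply/negbTE; rewrite negb_and; case: (sval w).2 => [[s i]|] /=;
    rewrite ?orbT // eqxx; apply/orP; right; lia.
- exact: cone_graph_action.
- have [[_ _ [X [finX X1 X2]] _] _] := ca.
  (* The whole cone over the coset [C] is finite and meets every orbit of new vertices. [F] is added
     so that the edges attaching this cone are included. *)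
  exists ((inl @` (X `|` F)) `|` (inr @` [set w | cone_coset w = lcos 1])).
  have tow w a : cone_coset w = lcos a -> exists2 w', cone_coset w' = lcos 1 &
      inr w = cone_act a (inr w').
    move=> wa; have [a1 aM _] := cone_graph_action.
    exists (exist _ _ (cone_ok_act a^-1 w)).
      by rewrite {1}/cone_coset /= wa ltrans_lcos mulVg.
    by rewrite -[inr (exist _ _ _)]/(cone_act a^-1 (inr w)) -aM mulgV a1.
  have tov w v : fill (cone_coset w) v -> forall a, cone_coset w = lcos a ->
      exists2 f, F f & v = act a f.
    by move=> + a wa; rewrite wa fill_lcos => -[f Ff <-]; exists f.
  split.
  - rewrite finite_setU; split; apply: finite_image;
    last exact: cone_coset_finite.
    by rewrite finite_setU.
  - move=> [v|w].
      have [g [x Xx ->]] := X1 v; exists g, (inl x) => //.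
      by left; exists x => //; left.
    have [a wa] := cone_cosetP w; have [w' w'1 ->] := tow w a wa.
    by exists a, (inr w') => //; right; exists w'.
  - move=> [u|w] [v|w'] uv.
    have [g [x [y [Xx Xy -> ->]]]] := X2 _ _ uv.
      by exists g, (inl x), (inl y); split=> //; left;
        [exists x|exists y] => //; left.
    have [a wa] := cone_cosetP w'; have [w1 w11 ->] := tow w' a wa.
      have [fu _] := cone_leg (eqP uv).
      have [f Ff ->] := tov _ _ fu a wa.
      by exists a, (inl f), (inr w1); split=> //; [left; exists f => //;
        right|right; exists w1].
    have [a wa] := cone_cosetP w; have [w1 w11 ->] := tow w a wa.
      have [fu _] := cone_leg (eqP uv).
      have [f Ff ->] := tov _ _ fu a wa.
      by exists a, (inr w1), (inl f); split=> //; [right; exists w1|left;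
        exists f => //; right].
    have [a wa] := cone_cosetP w; have [w1 w11 ->] := tow w a wa.
      move: uv => /= /andP [/asboolP ww' _]; rewrite wa in ww'.
      have [w2 w21 ->] := tow w' a (esym ww').
      by exists a, (inr w1), (inr w2); split=> //; right; [exists w1|exists w2].
- exact: cone_discrete.
split.
- move=> [u|w] q uq; last first.
    apply: cone_edge_stab_inr => // w' qE; move: uq; rewrite qE /=.
    by move=> /andP [/asboolP].
  case: q uq => [v|w] uq; last first.
    rewrite (_ : edge_stab _ _ _ = edge_stab cone_act (inr w) (inl u)).
      exact: cone_edge_stab_inr.
    by rewrite /edge_stab setUC.
  rewrite (_ : edge_stab _ _ _ = edge_stab act u v); first exact: eC.
  apply/seteqP; split=> g;
    rewrite /edge_stab /= !image_setU !image_set1 /= => E.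
    have pre a b : [set x | ([set inl a;
      inl b] : set (V + cone_vertex)%type) (inl x)]
        = [set a; b].
      by apply/seteqP; split=> x []; [case=> ->; left|case=> ->; right|
         move=> ->; left|move=> ->; right].
    by have := congr1 (fun B : set (V + cone_vertex)%type => [set x | B (inl
      x)]) E; rewrite !pre.
  have : (inl @` ([set act g u] `|` [set act g v]) : set (V +
    cone_vertex)%type) =
      inl @` [set u; v] by rewrite E.
  by rewrite !image_setU !image_set1.
- move=> [v|w]; last by left; exact: cone_stab_compact.
  by rewrite cone_stab_inl.
- by move=> H /HS [v vH]; exists (inl v); rewrite cone_stab_inl.
- move=> H p q HH_ nH pH qH.
  case: p pH => [u|w] pH; last by case: nH; rewrite -pH;
    exact: cone_stab_compact.
  case: q qH => [v|w] qH; last by case: nH; rewrite -qH;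
    exact: cone_stab_compact.
  rewrite !cone_stab_inl in pH qH; have [g ->] := orb _ _ _ HH_ nH pH qH.
  by exists g.
Qed.

(** The vertex is the tip of the cone over the trivial coset. *)
Lemma cone_star : exists p, vertex_stab cone_act p = C.
Proof.
have [w ww] : exists w : cone_vertex, sval w = (lcos 1, None).
  by apply: cone_make; split=> //; exists 1.
exists (inr w); rewrite (@cone_stab_inr _ 1); last by rewrite /cone_coset ww.
rewrite ww setIT; apply/seteqP; split=> g; rewrite /= conjg1 //.
Qed.

End Cone.

(** * Making a compact open subgroup a vertex stabilizer *)

Section CompactStabilizer.
Variables (A : topologicalGroupType) (HH : set (set A)).
Variables (V : choiceType) (e : rel V) (act : A -> V -> V) (C : set A).
Local Open Scope group_scope.
Hypotheses (ca : cayley_abels HH e act)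
  (sC : subgroup C) (oC : open C) (cC : compact C).

(** Vertex stabilizers are open, so the orbit map is locally constant on the compact set [C]. *)
Lemma orbit_finite v : finite_set [set act c v | c in C].
Proof.
apply: (compact_locally_constant (f := fun c => act c v)) => // c _.
have [[_ [_ aM _] _ [ov _]] _] := ca.
apply: filterS (nbhs_lcoset _ (ov v) c); last first.
  by apply: (@vertex_stab_subgroup _ _ e); split=> //; case: ca => -[_ []].
by move=> d /= dv; rewrite -{2}dv -aM mulVKg.
Qed.

(** The set is the union of chosen paths from [x0] to the points of [O']; an initial segment of such
    a path reaches any given vertex without leaving the union. *)
Lemma connected_hull x0 (O' : set V) : finite_set O' -> exists F n,
  [/\ finite_set F, O' `<=` F, F x0 & forall v, F v -> walk e F n x0 v].
Proof.
move=> finO.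
have econn u v : exists2 p, path e u p & last u p = v by case: ca => -[[]].
have [p pP] : {p : V -> seq V & forall v, path e x0 (p v) /\ last x0 (p v) = v}.
  apply: (@choice _ _ (fun v p => path e x0 p /\ last x0 p = v)) => v.
  by have [p pp lp] := econn x0 v; exists p.
pose F := [set x0] `|` \bigcup_(v in O') [set` x0 :: p v].
have finF : finite_set F.
  by rewrite /F finite_setU; split=> //; apply: bigcup_finite => // v _;
    exact: finite_seq.
have [n nP] : exists n, forall v, F v -> walk e F n x0 v.
  apply: finite_set_uniform => //.
    by move=> m n v mn; exact: walk_mono.
  move=> v [->|[w Ow wv]]; first by exists 0%N; split=> //; left.
  have [pw lw] := pP w; exists (size (p w)).
  have Fp : forall x, x \in x0 :: p w -> F x by move=> x xp; right; exists w.
  move: wv => /=; rewrite inE => /orP [/eqP ->|].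
    by apply: walk_refl; apply: Fp; rewrite inE eqxx.
  move=> vp; case/splitPr: vp pw lw Fp => p1 p2;
    rewrite cat_path => /andP [pp1 /= /andP [lv _]] _ Fp.
  apply/walkP; exists (rcons p1 v); rewrite rcons_path pp1 lv last_rcons;
    split=> //.
    by rewrite size_rcons size_cat /=; lia.
  move=> x; rewrite inE mem_rcons => xp; apply: Fp.
  by move: xp; rewrite !inE mem_cat inE => /or3P [->|->|->]; rewrite ?orbT.
exists F, n; split=> //; last by left.
move=> v Ov; right; exists v => //=; have [_ lv] := pP v.
by rewrite -[X in X \in _]lv mem_last.
Qed.

(* F consists of the C-translates of a
   finite connected set containing the orbit C x0. *)
Lemma invariant_hull x0 : exists F l,
  [/\ finite_set F, F x0, forall c v, C c -> F v -> F (act c v)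
    & forall u v, F u -> F v -> walk e F l u v].
Proof.
have [[[es _ _ _] actP _ _] _] := ca; have [a1 aM _] := actP.
have [F0 [n [finF0 OF F0x0 F0w]]] := connected_hull x0 (orbit_finite x0).
pose F := \bigcup_(v in F0) [set act c v | c in C].
have F0F : F0 `<=` F by move=> v Fv; exists v => //; exists 1;
  [exact: subgroup1|].
have FC c v : C c -> F v -> F (act c v).
  move=> Cc [w Fw [d Cd <-]]; exists w => //.
  by exists (c * d); [exact: subgroupM|].
have Fw v : F v -> walk e F (n + n) x0 v.
  move=> [w Fw [c Cc <-]]; apply: (@walk_cat _ _ _ _ _ _ (act c x0)).
    by apply: walk_mono (F0w _ _) => //; apply: OF; exists c.
  apply: walk_mono (walk_act actP c (F0w _ Fw)) => // _ [u Fu <-].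
  by apply: FC => //; exact: F0F.
exists F, ((n + n) + (n + n))%N; split=> //.
- by apply: bigcup_finite => // v _; exact: orbit_finite.
- exact: F0F.
- by move=> u v Fu Fv; apply: walk_cat (walk_sym es (Fw _ Fu)) (Fw _ Fv).
Qed.

Lemma cayley_abels_star (R : realType) : fine_graph e ->
  gromov_hyperbolic [set: V] (rdist R e) ->
  exists (V' : choiceType) (e' : rel V') (act' : A -> V' -> V') (star : V'),
    [/\ cayley_abels HH e' act', fine_graph e',
      gromov_hyperbolic [set: V'] (rdist R e') & vertex_stab act' star = C].
Proof.
move=> fe he; have [[[_ _ [x0] _] _ _ _] _] := ca.
have [F [l [finF Fx0 FC Fw]]] := invariant_hull x0.
have [star starP] := cone_star F l ca sC.
exists (V + cone_vertex act C F l)%type, (@cone_edge _ _ e act C F l),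
  (cone_act ca), star.
split=> //.
- exact: (cone_cayley_abels l ca sC oC cC finF Fx0 FC).
- exact: (cone_fine ca sC oC finF FC Fw).
- exact: (cone_hyperbolic ca sC Fx0 FC Fw).
Qed.

End CompactStabilizer.

(** * The combination theorem *)

Section Combination.
Variables (R : realType) (G : topologicalGroupType) (K : bool ->
  topologicalGroupType).
Variables (J : forall b, {multiplicative K b -> G}) (S : set G).
Variables (side : G -> bool -> bool) (HH : forall b, set (set (K b))).
Local Open Scope group_scope.
Hypotheses (Jopen : forall b, open_embedding (J b))
  (sS : subgroup S) (oS : open S) (cS : compact S) (SJ : forall b, S `<=` range
    (J b))
  (ind : forall P : set G, P 1 -> (forall b g a, P g -> P (g * J b a)) ->
     forall g, P g)
  (side_J : forall b g a, side (g * J b a) b = side g b)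
  (side_S : forall g, side g true (+) side g false = `[< S g >]).

Lemma hyperbolic_rel_tree : (forall b, hyperbolic_rel R (@HH b)) ->
  hyperbolic_rel R (tree_peripheral J HH).
Proof.
move=> hyp; have Jinj b : injective (J b) by case: (Jopen b).
have HHproper b : proper_pair (@HH b) by case: (hyp b).
have starred b : exists (V : choiceType) (e : rel V) (act : K b -> V -> V)
  (star : V),
    [/\ cayley_abels (@HH b) e act, fine_graph e,
      gromov_hyperbolic [set: V] (rdist R e) & vertex_stab act star = J b @^-1`
        S].
  have [_ [V [e [act [ca fe he]]]]] := hyp b.
  have [[[es _ _ econn] _ _ _] _] := ca.
  apply: (cayley_abels_star ca) => //;
    last exact/(hyperbolic_graphP R es econn).
  - split; first by rewrite /= gmulf1g; exact: subgroup1.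
    by move=> x y /= Sx Sy; rewrite gmulfM gmulfV; apply: sS.2.
  - by apply: open_comp oS => x _; case: (Jopen b).
  - apply: (open_embedding_compact_inv (Jopen b)).
    rewrite (_ : J b @` _ = S) //; apply/seteqP; split=> [_ [x Sx <-]//|x Sx].
    by have [a _ ax] := SJ b Sx; exists a; rewrite /= ax.
have [Vt [et [at_ [st [cat fet het stabt]]]]] := starred true.
have [Vf [ef [af [sf [caf fef hef stabf]]]]] := starred false.
pose V b : choiceType := if b then Vt else Vf.
pose e b : rel (V b) := if b as b0 return rel (V b0) then et else ef.
pose act b : K b -> V b -> V b :=
  if b as b0 return K b0 -> V b0 -> V b0 then at_ else af.
pose star b : V b := if b as b0 return V b0 then st else sf.
have ca b : cayley_abels (@HH b) (e b) (act b) by case: b.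
have conn b : connected_simplicial_graph (e b) by case: (ca b) => -[].
have star_stab b a : act b a (star b) = star b <-> S (J b a).
  have /seteqP [s1 s2] : vertex_stab (act b) (star b) = J b @^-1` S by case:
    (b).
  by split=> [/s1|/s2].
split; first exact: (tree_proper Jopen sS cS SJ ind side_J side_S).
exists (tvertex J (tree_actP ca)), (tedge star (actP := tree_actP ca)).
exists (tact (actP := tree_actP ca)); split.
- exact: (tree_cayley_abels Jopen sS cS SJ ind side_J side_S).
- by apply: (tree_fine Jinj sS SJ ind side_J side_S conn) => // -[].
- apply/hyperbolic_graphP.
  exact: tedge_sym.
  exact: tconn.
  by apply: (tree_hyperbolic Jinj sS SJ ind side_J side_S conn) => // -[].
Qed.

End Combination.

Theorem theorem1p1 (R : realType) (A B C G : topologicalGroupType)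
    (HA : set (set A)) (HB : set (set B))
    (iA : {multiplicative C -> A}) (iB : {multiplicative C -> B})
    (jA : {multiplicative A -> G}) (jB : {multiplicative B -> G}) :
  tdlc A -> tdlc B ->
  finite_open_collection HA -> finite_open_collection HB ->
  compactly_generated_rel HA -> compactly_generated_rel HB ->
  topological_amalgam iA iB jA jB ->
  range iA <> [set: A] -> range iB <> [set: B] ->
  hyperbolic_rel R HA -> hyperbolic_rel R HB ->
  compact [set: C] ->
  hyperbolic_rel R
    ([set jA @` H | H in HA] `|` [set jB @` H | H in HB]).
Proof.
move=> _ _ _ _ _ _ [oiA oiB am ojA ojB] _ _ hypA hypB cC.
(* The two factors are indexed by booleans, with [true] for [A] and [false] for [B], and [S] is the
   image of [C] in [G]. *)
pose K b : topologicalGroupType := if b then A else B.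
pose J b : {multiplicative K b -> G} :=
  if b as b0 return {multiplicative K b0 -> G} then jA else jB.
pose HH b : set (set (K b)) := if b as b0 return set (set (K b0)) then HA else
  HB.
pose S := range (jA \o iA).
have [ij _] := am.
have SE b : exists2 f : {multiplicative C -> K b}, open_embedding f & S = J b
  @` range f.
  case: b; first by exists iA; rewrite // /S image_comp.
  exists iB; rewrite // image_comp; apply: eq_imagel => c _; exact: ij.
have Jopen b : open_embedding (J b) by case: b.
have [sS oS] : open_subgroup S.
  have [f of_ ->] := SE true; apply: image_open_subgroup (Jopen true) _ _.
  by split; [exact: range_subgroup|exact: range_open].
have cS : compact S.
  have [f of_ ->] := SE true; apply: open_embedding_compact => //.
  exact: open_embedding_compact.
have SJ b : S `<=` range (J b).
  by have [f _ ->] := SE b => _ [a _ <-]; exists a.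
have [side [sideA sideB sideS]] := amalgam_side am.
rewrite (_ : _ `|` _ = tree_peripheral J HH); last first.
  apply/seteqP; split=> [H [HA_|HB_]|H [[] _ HH_]].
  - by exists true.
  - by exists false.
  - by left.
  - by right.
apply: (hyperbolic_rel_tree Jopen sS oS cS SJ (side := side)) => //.
- move=> P P1 PJ; apply: (amalgam_ind am) => // g.
    exact: (PJ true).
  exact: (PJ false).
- by case.
- by case.
Qed.
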